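(* Let $K$ be a field, let $F(X)$ and $F(Y)$ be the free Lie algebras over $K$ on sets $X$ and $Y$, and let $\phi:F(X)\to F(Y)$ be a homomorphism of Lie algebras. Then $\operatorname{cd}(\phi)\in\{0,1\}$. Moreover, if $\phi$ is not trivial (i.e. not the zero homomorphism), then $\operatorname{cd}(\phi)=1$.
   Context: Modules over a Lie algebra $\mathfrak g$ over $K$ are left $\mathfrak g$-modules, equivalently left modules over the universal enveloping algebra $U(\mathfrak g)$ (no finiteness assumption). $H^n(\mathfrak g,M)$ denotes Chevalley--Eilenberg cohomology (equivalently $\operatorname{Ext}^n_{U(\mathfrak g)}(K,M)$). For a Lie algebra homomorphism $\phi:\mathfrak g\to\mathfrak h$ and an $\mathfrak h$-module $M$, regarded as a $\mathfrak g$-module by restriction along $\phi$, there is an induced map $\phi^*:H^n(\mathfrak h,M)\to H^n(\mathfrak g,M)$ for each $n\ge 0$. The cohomological dimension of $\phi$ is $$\operatorname{cd}(\phi)=\sup\{n\ge 0:\ \text{there is an }\mathfrak h\text{-module }M\text{ with }\phi^*:H^n(\mathfrak h,M)\to H^n(\mathfrak g,M)\text{ nonzero}\},$$ a value in $\{0,1,2,\dots\}\cup\{\infty\}$. *)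

(* Defs.v *)
From HB Require Import structures.
From mathcomp Require Import all_boot all_order all_algebra.
From mathcomp Require Import boolp classical_sets functions constructive_ereal.

Set Implicit Arguments.
Unset Strict Implicit.
Unset Printing Implicit Defensive.

Import GRing.Theory.
Local Open Scope ring_scope.

HB.mixin Record isLieAlgebra (K : fieldType) L of GRing.Lmodule K L := {
  bracket : L -> L -> L;
  bracket_linearl : forall (a : K) (x y z : L),
    bracket (a *: x + y) z = a *: bracket x z + bracket y z;
  bracket_linearr : forall (a : K) (x y z : L),
    bracket z (a *: x + y) = a *: bracket z x + bracket z y;
  bracketxx : forall x : L, bracket x x = 0;
  bracket_jacobi : forall x y z : L,
    bracket x (bracket y z) + bracket y (bracket z x)
      + bracket z (bracket x y) = 0
}.

#[short(type="lieAlgType")]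
HB.structure Definition LieAlgebra (K : fieldType) :=
  {L of GRing.Lmodule K L & isLieAlgebra K L}.

HB.mixin Record isLieMorphism (K : fieldType) (g h : lieAlgType K)
    (f : g -> h) := {
  morph_bracket : forall x y, f (bracket x y) = bracket (f x) (f y)
}.

HB.structure Definition LieMorphism (K : fieldType) (g h : lieAlgType K) :=
  {f of isLieMorphism K g h f & @GRing.Linear K g h *:%R f}.

Notation "{ 'lie' g -> h }" := (LieMorphism.type g h)
  (at level 0, g at level 98, h at level 99, format "{ 'lie'  g  ->  h }").

HB.mixin Record isLieModule (K : fieldType) (g : lieAlgType K) M
    of GRing.Lmodule K M := {
  lact : g -> M -> M;
  lact_linearl : forall (a : K) (x y : g) (m : M),
    lact (a *: x + y) m = a *: lact x m + lact y m;
  lact_linearr : forall (a : K) (x : g) (m n : M),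
    lact x (a *: m + n) = a *: lact x m + lact x n;
  lact_bracket : forall (x y : g) (m : M),
    lact (bracket x y) m = lact x (lact y m) - lact y (lact x m)
}.

#[short(type="lieModType")]
HB.structure Definition LieModule (K : fieldType) (g : lieAlgType K) :=
  {M of GRing.Lmodule K M & isLieModule K g M}.

Section Restriction.
Variables (K : fieldType) (g h : lieAlgType K) (phi : {lie g -> h}).
Variable M : lieModType h.

(* An alias of the carrier of M on which g acts through phi. *)
Definition restr (f : g -> h) (N : Type) : Type := N.

HB.instance Definition _ := GRing.Lmodule.on (restr phi M).

Let restr_act (x : g) (m : restr phi M) : restr phi M :=
  lact (phi x) (m : M).

Let restr_linearl (a : K) (x y : g) (m : restr phi M) :
  restr_act (a *: x + y) m = a *: restr_act x m + restr_act y m.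
Proof. by rewrite /restr_act linearP lact_linearl. Qed.

Let restr_linearr (a : K) (x : g) (m n : restr phi M) :
  restr_act x (a *: m + n) = a *: restr_act x m + restr_act x n.
Proof. exact: lact_linearr. Qed.

Let restr_bracket (x y : g) (m : restr phi M) :
  restr_act (bracket x y) m
  = restr_act x (restr_act y m) - restr_act y (restr_act x m).
Proof. by rewrite /restr_act morph_bracket lact_bracket. Qed.

HB.instance Definition _ := isLieModule.Build K g (restr phi M)
  restr_linearl restr_linearr restr_bracket.

End Restriction.

Section Cochains.
Variables (K : fieldType) (g : lieAlgType K) (M : lieModType g).

Definition multilinear n (f : ('I_n -> g) -> M) : Prop :=
  forall (x : 'I_n -> g) (i : 'I_n) (a : K) (u v : g),
    f [eta x with i |-> a *: u + v]
    = a *: f [eta x with i |-> u] + f [eta x with i |-> v].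

Definition alternating n (f : ('I_n -> g) -> M) : Prop :=
  forall (x : 'I_n -> g) (i j : 'I_n), i != j -> x i = x j -> f x = 0.

Definition is_cochain n (f : ('I_n -> g) -> M) : Prop :=
  multilinear f /\ alternating f.

(* For i < j this is the family [x_i, x_j], x_0, ..., x_n with x_i and x_j
   omitted from the tail: [bump j (bump i p)] is the p-th natural number
   distinct from i and j. *)
Definition contract n (x : 'I_n.+1 -> g) (i j : 'I_n.+1) : 'I_n -> g :=
  fun k => if val k is p.+1 then x (inord (bump j (bump i p)))
           else bracket (x i) (x j).

Definition ce_diff n (f : ('I_n -> g) -> M) : ('I_n.+1 -> g) -> M :=
  fun x =>
    \sum_(i < n.+1) (-1) ^+ i *: lact (x i) (f (x \o lift i))
    + \sum_(i < n.+1) \sum_(j < n.+1 | (i < j)%N)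
        (-1) ^+ (i + j) *: f (contract x i j).

Definition is_cocycle n (f : ('I_n -> g) -> M) : Prop :=
  is_cochain f /\ ce_diff f = 0.

Definition is_coboundary n : (('I_n -> g) -> M) -> Prop :=
  match n with
  | 0 => fun f => f = 0
  | m.+1 => fun f => exists2 b : ('I_m -> g) -> M, is_cochain b & f = ce_diff b
  end.

Lemma lact_sub (x : g) (m n : M) : lact x (m - n) = lact x m - lact x n.
Proof. by rewrite addrC -scaleN1r lact_linearr scaleN1r [RHS]addrC. Qed.

Lemma is_cochain0 n : is_cochain (0 : ('I_n -> g) -> M).
Proof.
split=> [x i a u v|x i j _ _]; last by [].
by rewrite [RHS]addr0 [RHS]scaler0.
Qed.

Lemma is_cochainB n (f f' : ('I_n -> g) -> M) :
  is_cochain f -> is_cochain f' -> is_cochain (f - f').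
Proof.
move=> [fl fa] [fl' fa']; split=> [x i a u v|x i j ij xij].
  by rewrite !fctE fl fl' scalerBr opprD addrACA.
by rewrite !fctE (fa _ _ _ ij xij) (fa' _ _ _ ij xij) subrr.
Qed.

Lemma ce_diffB n (f f' : ('I_n -> g) -> M) :
  ce_diff (f - f') = ce_diff f - ce_diff f'.
Proof.
apply/funext => x; rewrite !fctE /ce_diff opprD addrACA -!sumrB.
congr (_ + _); apply: eq_bigr => i _; first by rewrite lact_sub scalerBr.
by rewrite -sumrB; apply: eq_bigr => j _; rewrite scalerBr.
Qed.

Lemma ce_diff0 n : ce_diff (0 : ('I_n -> g) -> M) = 0.
Proof. by rewrite -(subrr (0 : ('I_n -> g) -> M)) ce_diffB !subrr. Qed.

Definition cocycles n (f : ('I_n -> g) -> M) : bool := `[< is_cocycle f >].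

Lemma cocycles_zmod_closed n : zmod_closed (@cocycles n).
Proof.
split=> [|f f' /asboolP[fc fd] /asboolP[fc' fd']]; apply/asboolP.
  by split; [exact: is_cochain0|exact: ce_diff0].
by split; [exact: is_cochainB|rewrite ce_diffB fd fd' subrr].
Qed.

HB.instance Definition _ n :=
  GRing.isZmodClosed.Build (('I_n -> g) -> M) (@cocycles n)
    (@cocycles_zmod_closed n).

Record cocycle n := Cocycle {
  cocycle_fun :> ('I_n -> g) -> M;
  _ : cocycle_fun \in @cocycles n
}.

HB.instance Definition _ n := [isSub for @cocycle_fun n].
HB.instance Definition _ n := [Choice of cocycle n by <:].
HB.instance Definition _ n := [SubChoice_isSubZmodule of cocycle n by <:].

Lemma cocycleP n (z : cocycle n) : is_cocycle z.
Proof. by apply/asboolP; exact: (valP z). Qed.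

Definition coboundaries n (z : cocycle n) : bool :=
  `[< is_coboundary (z : ('I_n -> g) -> M) >].

Lemma coboundaries_zmod_closed n : zmod_closed (@coboundaries n).
Proof.
case: n => [|n]; split.
- exact/asboolP.
- by move=> z z' /asboolP/= z0 /asboolP/= z'0; apply/asboolP; rewrite /= z0 z'0 subrr.
- by apply/asboolP; exists 0; [exact: is_cochain0|rewrite ce_diff0].
- move=> z z' /asboolP[b bc zb] /asboolP[b' bc' zb']; apply/asboolP.
  by exists (b - b'); [exact: is_cochainB|rewrite ce_diffB -zb -zb'].
Qed.

HB.instance Definition _ n :=
  GRing.isZmodClosed.Build (cocycle n) (@coboundaries n)
    (@coboundaries_zmod_closed n).

End Cochains.

Definition cohomology (K : fieldType) n (g : lieAlgType K) (M : lieModType g) :=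
  Quotient.quot (GRing.ZmodClosed.clone _ (@coboundaries K g M n) _).

HB.instance Definition _ (K : fieldType) n (g : lieAlgType K)
    (M : lieModType g) := GRing.Zmodule.on (cohomology n M).

Definition coh_class (K : fieldType) n (g : lieAlgType K) (M : lieModType g)
  (z : cocycle M n) : cohomology n M := \pi_(cohomology n M)%qT z.

Definition coh_repr (K : fieldType) n (g : lieAlgType K) (M : lieModType g)
  (c : cohomology n M) : cocycle M n := repr c.

Lemma coh_classE (K : fieldType) n (g : lieAlgType K) (M : lieModType g)
  (z z' : cocycle M n) :
  coh_class z = coh_class z' <-> is_coboundary (val (z - z')).
Proof.
rewrite (rwP eqP) -Quotient.idealrBE; split=> [/asboolP//|zz'].
exact/asboolP.
Qed.

Lemma coh_reprK (K : fieldType) n (g : lieAlgType K) (M : lieModType g)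
  (c : cohomology n M) : coh_class (coh_repr c) = c.
Proof. exact: reprK. Qed.

Section InducedMap.
Variables (K : fieldType) (g h : lieAlgType K) (phi : {lie g -> h}).
Variables (M : lieModType h).

Definition pullback n (f : ('I_n -> h) -> M) : ('I_n -> g) -> restr phi M :=
  fun x => f (phi \o x).

Lemma phi_with n (x : 'I_n -> g) i u :
  phi \o [eta x with i |-> u] = [eta phi \o x with i |-> phi u].
Proof. by apply/funext => k /=; case: eqP. Qed.

Lemma pullback_cochain n (f : ('I_n -> h) -> M) :
  is_cochain f -> is_cochain (pullback f).
Proof.
move=> [fl fa]; split=> [x i a u v|x i j ij xij]; rewrite /pullback.
  by rewrite !phi_with linearP; exact: fl.
by apply: (fa _ i j) => //=; rewrite xij.
Qed.

Lemma pullback_diff n (f : ('I_n -> h) -> M) :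
  ce_diff (pullback f) = pullback (ce_diff f).
Proof.
apply/funext => x; rewrite /pullback /ce_diff; congr (_ + _).
apply: eq_bigr => i _; apply: eq_bigr => j _; congr (_ *: f _).
apply/funext => k; rewrite /contract /=.
by case: (val k) => //; rewrite morph_bracket.
Qed.

Lemma pullback_cocycle n (z : cocycle M n) :
  pullback z \in @cocycles K g (restr phi M) n.
Proof.
have [zc zd] := cocycleP z; apply/asboolP; split.
  exact: pullback_cochain.
by rewrite pullback_diff zd.
Qed.

Definition cocycle_pullback n (z : cocycle M n) : cocycle (restr phi M) n :=
  Cocycle (pullback_cocycle z).

Definition induced n (c : cohomology n M) : cohomology n (restr phi M) :=
  coh_class (cocycle_pullback (coh_repr c)).

Lemma induced_class n (z : cocycle M n) :
  induced (coh_class z) = coh_class (cocycle_pullback z).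
Proof.
apply/coh_classE.
have /coh_classE := coh_reprK (coh_class z).
rewrite !raddfB /=; case: n z => [|n] z /= => [/eqP|[b bc zb]].
  by rewrite subr_eq0 => /eqP ->; rewrite subrr.
exists (pullback b); first exact: pullback_cochain.
by rewrite pullback_diff -zb.
Qed.

End InducedMap.

Section CohomologicalDimension.
Variables (K : fieldType) (g h : lieAlgType K) (phi : {lie g -> h}).

Definition cd_degrees : set nat :=
  [set n | exists (M : lieModType h) (c : cohomology n M), induced phi c <> 0].

(* Every nonempty set of naturals has a supremum in [\bar int], equal to [+oo]
   when the set is unbounded. Since [cd_degrees] contains 0 (take the trivial
   module K), the default value of [supremum] is never used. *)
Definition cd : \bar int :=
  supremum 0%:E [set (n%:Z)%:E | n in cd_degrees].

End CohomologicalDimension.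

Section FreeLieAlgebra.
Variables (K : fieldType) (X : Type).

Inductive lie_term : Type :=
| Tvar of X
| Tzero
| Topp of lie_term
| Tadd of lie_term & lie_term
| Tscale of K & lie_term
| Tbracket of lie_term & lie_term.

Inductive lie_eqv : lie_term -> lie_term -> Prop :=
| eqv_refl t : lie_eqv t t
| eqv_sym s t : lie_eqv s t -> lie_eqv t s
| eqv_trans s t u : lie_eqv s t -> lie_eqv t u -> lie_eqv s u
| eqv_opp s s' : lie_eqv s s' -> lie_eqv (Topp s) (Topp s')
| eqv_add s s' t t' : lie_eqv s s' -> lie_eqv t t' ->
    lie_eqv (Tadd s t) (Tadd s' t')
| eqv_scale a s s' : lie_eqv s s' -> lie_eqv (Tscale a s) (Tscale a s')
| eqv_bracket s s' t t' : lie_eqv s s' -> lie_eqv t t' ->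
    lie_eqv (Tbracket s t) (Tbracket s' t')
| eqv_addA s t u : lie_eqv (Tadd s (Tadd t u)) (Tadd (Tadd s t) u)
| eqv_addC s t : lie_eqv (Tadd s t) (Tadd t s)
| eqv_add0 s : lie_eqv (Tadd Tzero s) s
| eqv_addN s : lie_eqv (Tadd (Topp s) s) Tzero
| eqv_scaleA a b s : lie_eqv (Tscale a (Tscale b s)) (Tscale (a * b) s)
| eqv_scale1 s : lie_eqv (Tscale 1 s) s
| eqv_scaleDr a s t :
    lie_eqv (Tscale a (Tadd s t)) (Tadd (Tscale a s) (Tscale a t))
| eqv_scaleDl a b s :
    lie_eqv (Tscale (a + b) s) (Tadd (Tscale a s) (Tscale b s))
| eqv_linearl a s t u : lie_eqv (Tbracket (Tadd (Tscale a s) t) u)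
    (Tadd (Tscale a (Tbracket s u)) (Tbracket t u))
| eqv_linearr a s t u : lie_eqv (Tbracket u (Tadd (Tscale a s) t))
    (Tadd (Tscale a (Tbracket u s)) (Tbracket u t))
| eqv_bracketxx s : lie_eqv (Tbracket s s) Tzero
| eqv_jacobi s t u :
    lie_eqv (Tadd (Tadd (Tbracket s (Tbracket t u)) (Tbracket t (Tbracket u s)))
                  (Tbracket u (Tbracket s t))) Tzero.

HB.instance Definition _ := gen_eqMixin lie_term.
HB.instance Definition _ := gen_choiceMixin lie_term.

Definition lie_eqvb : rel lie_term := fun s t => `[< lie_eqv s t >].

Lemma lie_eqvb_equiv : equiv_class_of lie_eqvb.
Proof.
split=> [s|s t|t s u].
- by apply/asboolP; exact: eqv_refl.
- by apply/asboolP/asboolP; exact: eqv_sym.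
- by move=> /asboolP st /asboolP tu; apply/asboolP; exact: eqv_trans st tu.
Qed.

Canonical lie_eqv_equiv := EquivRelPack lie_eqvb_equiv.
Canonical lie_eqv_encModRel := defaultEncModRel lie_eqvb.

Definition freeLie := {eq_quot lie_eqvb}%qT.

HB.instance Definition _ := Choice.on freeLie.

Definition fl_class (t : lie_term) : freeLie := \pi_freeLie%qT t.

Lemma fl_classP s t : fl_class s = fl_class t <-> lie_eqv s t.
Proof.
split=> [/eqP|st]; last by apply/eqP; rewrite eqmodE; apply/asboolP.
by rewrite eqmodE => /asboolP.
Qed.

Lemma fl_classW (P : freeLie -> Prop) : (forall t, P (fl_class t)) -> forall u, P u.
Proof. by move=> Pt u; rewrite -(reprK u). Qed.

Lemma repr_fl_class t : lie_eqv (repr (fl_class t)) t.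
Proof. by apply/fl_classP; exact: reprK. Qed.

Definition fl_opp (u : freeLie) := fl_class (Topp (repr u)).
Definition fl_add (u v : freeLie) := fl_class (Tadd (repr u) (repr v)).
Definition fl_scale a (u : freeLie) := fl_class (Tscale a (repr u)).
Definition fl_bracket (u v : freeLie) := fl_class (Tbracket (repr u) (repr v)).

Lemma fl_class_opp t : fl_opp (fl_class t) = fl_class (Topp t).
Proof. by apply/fl_classP/eqv_opp/repr_fl_class. Qed.

Lemma fl_class_add s t : fl_add (fl_class s) (fl_class t) = fl_class (Tadd s t).
Proof. by apply/fl_classP/eqv_add; exact: repr_fl_class. Qed.

Lemma fl_class_scale a t : fl_scale a (fl_class t) = fl_class (Tscale a t).
Proof. by apply/fl_classP/eqv_scale/repr_fl_class. Qed.

Lemma fl_class_bracket s t : fl_bracket (fl_class s) (fl_class t) = fl_class (Tbracket s t).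
Proof. by apply/fl_classP/eqv_bracket; exact: repr_fl_class. Qed.

Let fl_classE := (fl_class_opp, fl_class_add, fl_class_scale, fl_class_bracket).

Lemma fl_addA : associative fl_add.
Proof.
do 3![elim/fl_classW=> ?]; rewrite !fl_classE; apply/fl_classP; exact: eqv_addA.
Qed.

Lemma fl_addC : commutative fl_add.
Proof. by do 2![elim/fl_classW=> ?]; rewrite !fl_classE; apply/fl_classP; exact: eqv_addC. Qed.

Lemma fl_add0 : left_id (fl_class Tzero) fl_add.
Proof. by elim/fl_classW=> ?; rewrite !fl_classE; apply/fl_classP; exact: eqv_add0. Qed.

Lemma fl_addN : left_inverse (fl_class Tzero) fl_opp fl_add.
Proof. by elim/fl_classW=> ?; rewrite !fl_classE; apply/fl_classP; exact: eqv_addN. Qed.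

HB.instance Definition _ :=
  GRing.isZmodule.Build freeLie fl_addA fl_addC fl_add0 fl_addN.

Lemma fl_scaleA a b u : fl_scale a (fl_scale b u) = fl_scale (a * b) u.
Proof. by elim/fl_classW: u => ?; rewrite !fl_classE; apply/fl_classP; exact: eqv_scaleA. Qed.

Lemma fl_scale1 : left_id 1 fl_scale.
Proof. by elim/fl_classW=> ?; rewrite !fl_classE; apply/fl_classP; exact: eqv_scale1. Qed.

Lemma fl_scaleDr : right_distributive fl_scale +%R.
Proof.
move=> a; do 2![elim/fl_classW=> ?]; rewrite /+%R /= !fl_classE; apply/fl_classP.
exact: eqv_scaleDr.
Qed.

Lemma fl_scaleDl u : {morph fl_scale^~ u : a b / a + b}.
Proof.
by elim/fl_classW: u => ? a b; rewrite [RHS]/+%R /= !fl_classE; apply/fl_classP; exact: eqv_scaleDl.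
Qed.

HB.instance Definition _ := GRing.Zmodule_isLmodule.Build K freeLie
  fl_scaleA fl_scale1 fl_scaleDr fl_scaleDl.

Let addE (u v : freeLie) : u + v = fl_add u v. Proof. by []. Qed.
Let scaleE a (u : freeLie) : a *: u = fl_scale a u. Proof. by []. Qed.

Lemma fl_linearl a (u v w : freeLie) :
  fl_bracket (a *: u + v) w = a *: fl_bracket u w + fl_bracket v w.
Proof.
rewrite !addE !scaleE; elim/fl_classW: u => ?; elim/fl_classW: v => ?.
by elim/fl_classW: w => ?; rewrite !fl_classE; apply/fl_classP; exact: eqv_linearl.
Qed.

Lemma fl_linearr a (u v w : freeLie) :
  fl_bracket w (a *: u + v) = a *: fl_bracket w u + fl_bracket w v.
Proof.
rewrite !addE !scaleE; elim/fl_classW: u => ?; elim/fl_classW: v => ?.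
by elim/fl_classW: w => ?; rewrite !fl_classE; apply/fl_classP; exact: eqv_linearr.
Qed.

Lemma fl_bracketxx (u : freeLie) : fl_bracket u u = 0.
Proof. by elim/fl_classW: u => ?; rewrite !fl_classE; apply/fl_classP; exact: eqv_bracketxx. Qed.

Lemma fl_jacobi (u v w : freeLie) :
  fl_bracket u (fl_bracket v w) + fl_bracket v (fl_bracket w u)
    + fl_bracket w (fl_bracket u v) = 0.
Proof.
rewrite !addE; elim/fl_classW: u => ?; elim/fl_classW: v => ?.
by elim/fl_classW: w => ?; rewrite !fl_classE; apply/fl_classP; exact: eqv_jacobi.
Qed.

HB.instance Definition _ := isLieAlgebra.Build K freeLie
  fl_linearl fl_linearr fl_bracketxx fl_jacobi.

Definition fl_var (x : X) : freeLie := fl_class (Tvar x).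

End FreeLieAlgebra.

Section UniversalProperty.
Variables (K : fieldType) (X : Type) (L : lieAlgType K) (f : X -> L).

Fixpoint lie_eval (t : lie_term K X) : L :=
  match t with
  | Tvar x => f x
  | Tzero => 0
  | Topp s => - lie_eval s
  | Tadd s t => lie_eval s + lie_eval t
  | Tscale a s => a *: lie_eval s
  | Tbracket s t => bracket (lie_eval s) (lie_eval t)
  end.

Lemma lie_eval_eqv s t : lie_eqv s t -> lie_eval s = lie_eval t.
Proof.
elim=> //=; try congruence.
- by move=> *; exact: addrA.
- by move=> *; exact: addrC.
- by move=> *; exact: add0r.
- by move=> *; exact: addNr.
- by move=> *; exact: scalerA.
- by move=> *; exact: scale1r.
- by move=> *; exact: scalerDr.
- by move=> *; exact: scalerDl.
- by move=> *; exact: bracket_linearl.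
- by move=> *; exact: bracket_linearr.
- by move=> *; exact: bracketxx.
- by move=> *; exact: bracket_jacobi.
Qed.

Definition fl_lift (u : freeLie K X) : L := lie_eval (repr u).

Lemma fl_liftE t : fl_lift (fl_class t) = lie_eval t.
Proof. exact/lie_eval_eqv/repr_fl_class. Qed.

Lemma fl_lift_linear : linear fl_lift.
Proof.
move=> a; elim/fl_classW=> s; elim/fl_classW=> t.
have -> : a *: fl_class s + fl_class t = fl_class (Tadd (Tscale a s) t).
  by rewrite -fl_class_add -fl_class_scale.
by rewrite !fl_liftE.
Qed.

Lemma fl_lift_bracket u v :
  fl_lift (bracket u v) = bracket (fl_lift u) (fl_lift v).
Proof.
elim/fl_classW: u => s; elim/fl_classW: v => t.
have -> : bracket (fl_class s) (fl_class t) = fl_class (Tbracket s t) by rewrite -fl_class_bracket.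
by rewrite !fl_liftE.
Qed.

HB.instance Definition _ := GRing.isLinear.Build K (freeLie K X) L *:%R fl_lift
  fl_lift_linear.
HB.instance Definition _ := isLieMorphism.Build K (freeLie K X) L fl_lift
  fl_lift_bracket.

Lemma freeLie_universal :
  exists phi : {lie freeLie K X -> L}, (forall x, phi (fl_var K x) = f x)
  /\ forall psi : {lie freeLie K X -> L}, (forall x, psi (fl_var K x) = f x) ->
     psi =1 phi.
Proof.
exists (fl_lift : {lie _ -> _}); split=> [x|psi psif].
  by rewrite /= fl_liftE.
elim/fl_classW=> t /=; rewrite fl_liftE; elim: t => [x||s IH|s IHs t IHt|a s IH|s IHs t IHt] /=.
- exact: psif.
- exact: (raddf0 psi).
- by rewrite -IH -raddfN; congr (psi _); rewrite -fl_class_opp.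
- by rewrite -IHs -IHt -raddfD; congr (psi _); rewrite -fl_class_add.
- by rewrite -IH -linearZ; congr (psi _); rewrite -fl_class_scale.
- by rewrite -IHs -IHt -morph_bracket; congr (psi _); rewrite -fl_class_bracket.
Qed.

End UniversalProperty.

(* Main.v *)
From HB Require Import structures.
From mathcomp Require Import all_boot all_order all_algebra.
From mathcomp Require Import fingroup perm ssrAC zify.
From mathcomp Require Import boolp classical_sets functions constructive_ereal.
From mathcomp Require Import wochoice.
Require Import Defs.

Set Implicit Arguments.
Unset Strict Implicit.
Unset Printing Implicit Defensive.

Import GRing.Theory.
Local Open Scope ring_scope.

(**
In degrees n >= 2 the cohomology of a free Lie algebra F vanishes. For n = 2
this holds because the Lie algebra extension defined by a 2-cocycle splits over
F. For n > 2 shift dimension along M -> coindMod M, where coindMod M is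
Hom_K(U(g), M), encoded as the multilinear functions on words in g compatible
with x y - y x = [x, y]. By the Poincare-Birkhoff-Witt theorem such a function
is determined by arbitrary values on sorted words in an ordered basis of g, and
the Koszul contraction on sorted words, applied length by length, makes every
cocycle of positive degree with values in coindMod M a coboundary; this part is
valid for every Lie algebra.

If v = phi u is nonzero, v acts nontrivially on functions on words in Y, again
by Poincare-Birkhoff-Witt. Take c minimal such that v psi is nonzero at the empty
word for some psi supported on words of length <= c. Then D x = x psi is a
1-cocycle with values in the functions supported on words of length < c, and
D v is not of the form v m, so the pullback of D along phi is not a coboundary.
*)

(** * Chevalley-Eilenberg calculus *)


(** The free resolution of length one of K over U(F(Y)) bounds Ext, but [cohomology] is given by
    Chevalley-Eilenberg cochains, and comparing the two already rests on Poincare-Birkhoff-Witt.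
    That theorem is therefore used inside the cochain complex, in dual form: no enveloping algebra
    is built, only functions on words. The contraction goes by length because [ce_diff] on
    [coindMod] has two parts: action terms evaluate a cochain on words one letter longer, bracket
    terms keep the word. On the lowest length where a cochain is nonzero, words behave as
    commutative monomials and the action terms form a Koszul differential. Each correction pushes
    the error to longer words, so the infinite sum of corrections is finite on every word; this
    requires functions of unrestricted support. Degree one needs the opposite. Among all functions D
    is the coboundary of psi itself. Coefficients supported on lengths below c still contain every
    value x psi, since elements of F(Y) have no constant term, but no longer contain psi, and the
    minimality of c excludes any other primitive. *)

Section LieLinear.
Variables (K : fieldType) (g : lieAlgType K) (M : lieModType g).

HB.instance Definition _ (x : g) :=
  GRing.isLinear.Build K g g *:%R (bracket x)
    (fun a u v => bracket_linearr a u v x).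
HB.instance Definition _ (x : g) :=
  GRing.isLinear.Build K M M *:%R (@lact K g M x) (lact_linearr ^~ x).

Lemma bracketDl (x y z : g) : bracket (x + y) z = bracket x z + bracket y z.
Proof. by rewrite -{1}[x]scale1r bracket_linearl scale1r. Qed.

Lemma bracketC (x y : g) : bracket x y = - bracket y x.
Proof.
apply/eqP; rewrite -addr_eq0; have := bracketxx (x + y).
by rewrite bracketDl !raddfD /= !bracketxx add0r addr0 => ->.
Qed.

Lemma bracket_der (x y z : g) :
  bracket x (bracket y z) = bracket (bracket x y) z + bracket y (bracket x z).
Proof.
apply/eqP; rewrite -subr_eq0 -(bracket_jacobi x y z) opprD.
rewrite [bracket z x]bracketC [bracket (bracket x y) z]bracketC !raddfN /= opprK.
by rewrite -addrA [bracket z _ - _]addrC addrA.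
Qed.

Lemma lactDl (x y : g) (m : M) : lact (x + y) m = lact x m + lact y m.
Proof. by rewrite -{1}[x]scale1r lact_linearl scale1r. Qed.

Lemma lactZl a (x : g) (m : M) : lact (a *: x) m = a *: lact x m.
Proof.
have lact0 : lact 0 m = 0.
  by apply: (addIr (lact 0 m)); rewrite -lactDl addr0 add0r.
by rewrite -[a *: x]addr0 lact_linearl lact0 addr0.
Qed.

End LieLinear.

(** * Families with a prepended argument *)

Section Prepend.
Variable T : Type.

Definition prep n (x : T) (u : 'I_n -> T) : 'I_n.+1 -> T :=
  fun k => if unlift ord0 k is Some j then u j else x.

Lemma prep0 n x (u : 'I_n -> T) : prep x u ord0 = x.
Proof. by rewrite /prep unlift_none. Qed.

Lemma prepS n x (u : 'I_n -> T) j : prep x u (lift ord0 j) = u j.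
Proof. by rewrite /prep liftK. Qed.

Lemma prepP n (v : 'I_n.+1 -> T) x u :
  v ord0 = x -> (forall j, v (lift ord0 j) = u j) -> v = prep x u.
Proof.
move=> v0 vS; apply/funext => k; case: (unliftP ord0 k) => [j|] ->.
  by rewrite prepS vS.
by rewrite prep0 v0.
Qed.

Lemma prepE n (v : 'I_n.+1 -> T) : v = prep (v ord0) (v \o lift ord0).
Proof. exact: prepP. Qed.

End Prepend.

Lemma prep_comp (T T' : Type) (h : T -> T') n x (u : 'I_n -> T) :
  h \o prep x u = prep (h x) (h \o u).
Proof. by apply: prepP => [|j] /=; rewrite ?prep0 ?prepS. Qed.

Lemma prep_with (T : Type) n (x v : T) (u : 'I_n -> T) j :
  prep x [eta u with j |-> v] = [eta prep x u with lift ord0 j |-> v].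
Proof.
symmetry; apply: prepP => [|k] /=; first by rewrite prep0.
by rewrite (inj_eq lift_inj) prepS.
Qed.

Lemma prep_with0 (T : Type) n (x v : T) (u : 'I_n -> T) :
  prep v u = [eta prep x u with ord0 |-> v].
Proof. by symmetry; apply: prepP => //= j; rewrite prepS. Qed.

Lemma prep_lift0 (T : Type) n (x : T) (u : 'I_n -> T) :
  prep x u \o lift ord0 = u.
Proof. by apply/funext => j /=; rewrite prepS. Qed.

Lemma lift_lift0 n (i : 'I_n.+1) (j : 'I_n) :
  lift (lift ord0 i) (lift ord0 j) = lift ord0 (lift i j).
Proof. by apply/val_inj; rewrite /= /bump /= !add1n ltnS addnS. Qed.

Lemma prep_lift (T : Type) n (x : T) (u : 'I_n.+1 -> T) i :
  prep x u \o lift (lift ord0 i) = prep x (u \o lift i).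
Proof.
apply: prepP => [|j] /=; last by rewrite lift_lift0 prepS.
have -> : lift (lift ord0 i) ord0 = ord0 :> 'I_n.+2 by apply/val_inj.
by rewrite prep0.
Qed.

Lemma with_same (T : Type) n (u : 'I_n -> T) i : u = [eta u with i |-> u i].
Proof. by apply/funext => k /=; case: eqP => // ->. Qed.

Lemma withC (T : Type) n (u : 'I_n -> T) i j a b : i != j ->
  [eta [eta u with i |-> a] with j |-> b] =
  [eta [eta u with j |-> b] with i |-> a] :> ('I_n -> T).
Proof.
move=> ij; apply/funext => k /=; case: eqP => // ->.
by rewrite eq_sym (negPf ij).
Qed.

Lemma with_lift (T : Type) n (u : 'I_n.+1 -> T) i j b :
  [eta u with lift i j |-> b] \o lift i = [eta u \o lift i with j |-> b].
Proof. by apply/funext => k /=; rewrite (inj_eq lift_inj). Qed.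

Lemma with_lift_self (T : Type) n (u : 'I_n.+1 -> T) i b :
  [eta u with i |-> b] \o lift i = u \o lift i.
Proof. by apply/funext => k /=; rewrite eq_sym (negPf (neq_lift i k)). Qed.

(** * Alternating maps under permutation of the arguments *)

Section Multilinear.
Variables (K : fieldType) (g : lieAlgType K) (M : lieModType g).

Lemma multilinear0 n (f : ('I_n -> g) -> M) u i :
  multilinear f -> u i = 0 -> f u = 0.
Proof.
move=> fl ui; have := fl u i 1 0 0; rewrite !scale1r addr0 -ui -with_same.
by move/eqP; rewrite -subr_eq0 opprD addrA subrr sub0r oppr_eq0 => /eqP.
Qed.

Lemma multilinearD n (f : ('I_n -> g) -> M) u i x y : multilinear f ->
  f [eta u with i |-> x + y] = f [eta u with i |-> x] + f [eta u with i |-> y].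
Proof. by move=> fl; rewrite -{1}(scale1r x) fl scale1r. Qed.

Lemma cochain_swap n (f : ('I_n -> g) -> M) u i j : is_cochain f -> i != j ->
  f (u \o tperm i j) = - f u.
Proof.
move=> [fl fa] ij; apply/eqP; rewrite -addr_eq0.
have -> : u \o tperm i j = [eta [eta u with i |-> u j] with j |-> u i].
  apply/funext => k /=; case: tpermP => [->|->|/eqP/negPf-> /eqP/negPf->//].
    by rewrite (negPf ij) eqxx.
  by rewrite eqxx.
pose W a b := f [eta [eta u with i |-> a] with j |-> b].
have Wr a b c : W a (b + c) = W a b + W a c by rewrite /W multilinearD.
have Wl a b c : W (a + b) c = W a c + W b c.
  by rewrite /W !(withC u _ _ ij) multilinearD.
have W0 a : W a a = 0.
  by apply: (fa _ i j ij); rewrite /= eqxx (negPf ij) eqxx.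
have Wu : f u = W (u i) (u j) by rewrite /W -with_same -with_same.
rewrite Wu -[f _]/(W (u j) (u i)) addrC.
by have := W0 (u i + u j); rewrite Wl !Wr !W0 add0r addr0 => ->.
Qed.

Lemma cochain_perm n (f : ('I_n -> g) -> M) (s : 'S_n) u : is_cochain f ->
  f (u \o s) = (-1) ^+ s *: f u.
Proof.
move=> fc; have [ts -> dts] := prod_tpermP s.
elim: ts dts u => [|t ts IH] /=.
  move=> _ u; rewrite big_nil odd_perm1 expr0 scale1r; congr f.
  by apply/funext => k; rewrite /= perm1.
move=> /andP[dt dts] u; rewrite big_cons.
have -> : u \o (tperm t.1 t.2 * \prod_(t0 <- ts) tperm t0.1 t0.2)%g =
          (u \o (\prod_(t0 <- ts) tperm t0.1 t0.2)%g) \o tperm t.1 t.2.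
  by apply/funext => k; rewrite /= permM.
rewrite cochain_swap // IH // odd_permM odd_tperm dt.
by rewrite -scaleNr signr_addb expr1 mulN1r.
Qed.

(** Moving argument [i] to the front is the cycle [lift_perm ord0 i 1], of sign (-1)^i. *)
Lemma cochain_front n (f : ('I_n.+1 -> g) -> M) i (u : 'I_n.+1 -> g) :
  is_cochain f ->
  f (prep (u i) (u \o lift i)) = (-1) ^+ i *: f u.
Proof.
move=> fc; transitivity (f (u \o lift_perm ord0 i 1)).
  congr f; symmetry; apply: prepP => [|j] /=; first by rewrite lift_perm_id.
  by rewrite lift_perm_lift perm1.
by rewrite cochain_perm // odd_lift_perm odd_perm1 addbF /= signr_odd.
Qed.

End Multilinear.

(** * Interior product and Lie derivative of cochains *)

Section Cartan.
Variables (K : fieldType) (g : lieAlgType K) (M : lieModType g).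

Definition inner n (x : g) (f : ('I_n.+1 -> g) -> M) : ('I_n -> g) -> M :=
  fun u => f (prep x u).

Definition lieD n (x : g) (f : ('I_n -> g) -> M) : ('I_n -> g) -> M :=
  fun u => lact x (f u) - \sum_i f [eta u with i |-> bracket x (u i)].

Lemma inner_cochain n x (f : ('I_n.+1 -> g) -> M) :
  is_cochain f -> is_cochain (inner x f).
Proof.
move=> [fl fa]; split=> [u i a v w|u i j ij uij]; rewrite /inner.
  by rewrite !prep_with fl.
by apply: (fa _ (lift ord0 i) (lift ord0 j)); rewrite ?(inj_eq lift_inj) ?prepS.
Qed.

Lemma inner_inner n x y (f : ('I_n.+2 -> g) -> M) : is_cochain f ->
  inner x (inner y f) = - inner y (inner x f).
Proof.
move=> fc; apply/funext => u; rewrite /inner !fctE.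
have := cochain_front (lift ord0 ord0) (prep x (prep y u)) fc.
by rewrite prep_lift prep_lift0 prepS prep0 expr1 scaleN1r => <-.
Qed.

Lemma lieD_cochain n x (f : ('I_n -> g) -> M) :
  is_cochain f -> is_cochain (lieD x f).
Proof.
move=> [fl fa]; split=> [u i a v w|u i j ij uij]; rewrite /lieD.
  rewrite fl linearP /= scalerBr [RHS]addrACA; congr (_ + _).
  rewrite scaler_sumr -!opprD -big_split /=; congr (- _).
  apply: eq_bigr => k _; rewrite eq_sym.
  have [->|ik] := eqVneq i k.
    have w1 (z z' : g) : [eta [eta u with k |-> z] with k |-> z']
        = [eta u with k |-> z'] :> ('I_n -> g).
      by apply/funext => l /=; case: eqP.
    by rewrite /= !w1 linearP fl.
  by rewrite !(withC _ _ _ ik) fl.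
rewrite (fa _ _ _ ij uij) raddf0 sub0r; apply/eqP; rewrite oppr_eq0; apply/eqP.
rewrite (bigD1 i) // (bigD1 j) 1?eq_sym //= big1 ?addr0.
  have -> : ([eta u with j |-> bracket x (u j)] : 'I_n -> g)
      = [eta u with i |-> bracket x (u i)] \o tperm i j.
    apply/funext => k /=; case: tpermP => [->|->|/eqP ki /eqP kj].
    - by rewrite (negPf ij) eq_sym (negPf ij).
    - by rewrite !eqxx uij.
    - by rewrite (negPf ki) (negPf kj).
  by rewrite cochain_swap // subrr.
move=> k /andP[ki kj]; apply: (fa _ i j ij) => /=.
by rewrite eq_sym (negPf ki) eq_sym (negPf kj).
Qed.

Lemma contract_prep0 n x (u : 'I_n.+1 -> g) j :
  contract (prep x u) ord0 (lift ord0 j)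
  = prep (bracket x (u j)) (u \o lift j).
Proof.
apply: prepP => [|k]; first by rewrite /contract /= prep0 prepS.
rewrite /contract /=; set y := prep x u _.
have -> : y = prep x u (lift ord0 (lift j k)).
  congr prep; apply/val_inj; rewrite -lift_lift0 /= inordK //.
  exact: (ltn_ord (lift (lift ord0 j) (lift ord0 k))).
by rewrite prepS.
Qed.

Lemma contract_prepS n x (u : 'I_n.+2 -> g) (i j : 'I_n.+2) : (i < j)%N ->
  contract (prep x u) (lift ord0 i) (lift ord0 j)
  = prep (bracket (u i) (u j)) (prep x (contract u i j \o lift ord0)).
Proof.
move=> ij; apply: prepP => [|k]; first by rewrite /contract /= !prepS.
case: (unliftP ord0 k) => [p|] ->; last first.
  rewrite prep0 /contract /= [inord _](_ : _ = ord0) ?prep0 //.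
  by apply/val_inj; rewrite /= inordK.
rewrite prepS /contract /=; set y := prep x u _.
have bumpW a b : (bump a b <= b.+1)%N by rewrite -add1n leq_add2r leq_b1.
have bp : (bump j (bump i p) < n.+2)%N.
  by rewrite ltnS (leq_trans (bumpW _ _)) // ltnS (leq_trans (bumpW _ _)).
have bumpS a b : bump a.+1 b.+1 = (bump a b).+1.
  by rewrite /bump ltnS addnS.
have -> : y = prep x u (lift ord0 (inord (bump j (bump i p)))).
  have bump0 a : bump 0 a = a.+1 by [].
  by congr prep; apply/val_inj; rewrite /= !bump0 !bumpS !inordK.
by rewrite prepS.
Qed.

(* Cartan's formula; it turns identities for [ce_diff] into inductions on the
   number of arguments that avoid the index bookkeeping of [contract]. *)
Lemma cartan n x (f : ('I_n.+1 -> g) -> M) : is_cochain f ->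
  inner x (ce_diff f) = lieD x f - ce_diff (inner x f).
Proof.
move=> fc; apply/funext => u; rewrite /inner /ce_diff /lieD !fctE.
rewrite big_ord_recl [X in _ + X = _]big_ord_recl /= expr0 scale1r prep0.
rewrite prep_lift0 -!addrA; congr (_ + _).
rewrite opprD [RHS]addrCA; congr (_ + (_ + _)).
- rewrite -sumrN; apply: eq_bigr => i _; rewrite prepS prep_lift.
  by rewrite /bump leq0n add1n exprS mulN1r scaleNr.
- rewrite big_mkcond big_ord_recl /= add0r -sumrN; apply: eq_bigr => j _.
  rewrite contract_prep0 add0n /bump leq0n add1n exprS mulN1r scaleNr.
  congr (- _); have := cochain_front j [eta u with j |-> bracket x (u j)] fc.
  by rewrite with_lift_self /= eqxx => ->; rewrite scalerA -signr_odd
    -signr_addb addbb scale1r.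
- case: n f fc u => [|n] f fc u.
    rewrite big1 => [|i _]; last first.
      by rewrite (ord1 i) big_pred0 // => -[[|[|j]]].
    rewrite big1 ?oppr0 // => i _; by apply: big1 => j; rewrite !ord1.
  rewrite -sumrN; apply: eq_bigr => i _; rewrite -sumrN.
  rewrite big_mkcond big_ord_recl /= add0r -big_mkcond /=.
  apply: eq_big => [j|j ij]; first by rewrite ltnS.
  rewrite contract_prepS //.
  rewrite -[f _]/(inner _ (inner _ f) _) inner_inner // fctE scalerN /inner.
  rewrite /bump !leq0n !add1n addSn addnS exprS exprS !mulN1r opprK.
  by congr (- (_ *: f (prep x _))); rewrite {2}[contract u i j]prepE.
Qed.

Lemma ce_diff_0 (f : ('I_0 -> g) -> M) x :
  inner x (ce_diff f) = fun u => lact x (f u).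
Proof.
apply/funext => u; rewrite /inner /ce_diff !big_ord_recl !big_ord0 /=.
rewrite big_mkcond big_ord_recl big_ord0 /= !addr0 scale1r prep0.
by congr (lact x (f _)); apply/funext; case.
Qed.

Lemma inner_ext n (f h : ('I_n.+1 -> g) -> M) :
  (forall x, inner x f = inner x h) -> f = h.
Proof.
move=> fh; apply/funext => u; rewrite (prepE u).
by have := congr1 (@^~ (u \o lift ord0)) (fh (u ord0)).
Qed.

Lemma innerB n x (f h : ('I_n.+1 -> g) -> M) :
  inner x (f - h) = inner x f - inner x h.
Proof. by []. Qed.

Lemma inner_linear n a x y (f : ('I_n.+1 -> g) -> M) : multilinear f ->
  inner (a *: x + y) f = a *: inner x f + inner y f.
Proof.
move=> fl; apply/funext => u; rewrite /inner !fctE.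
by rewrite (prep_with0 0) fl -!prep_with0.
Qed.

Lemma lieDB n x (f h : ('I_n -> g) -> M) :
  lieD x (f - h) = lieD x f - lieD x h.
Proof.
apply/funext => u; rewrite /lieD !fctE lact_sub sumrB /= !opprD !opprK.
by rewrite addrACA.
Qed.

Lemma lieD_linear n a x y (f : ('I_n -> g) -> M) : multilinear f ->
  lieD (a *: x + y) f = a *: lieD x f + lieD y f.
Proof.
move=> fl; apply/funext => u; rewrite /lieD !fctE lact_linearl scalerBr.
rewrite [RHS]addrACA; congr (_ + _); rewrite scaler_sumr -opprD -big_split /=.
by congr (- _); apply: eq_bigr => i _; rewrite bracket_linearl fl.
Qed.

Lemma ce_diff_linear n a (f h : ('I_n -> g) -> M) :
  ce_diff (a *: f + h) = a *: ce_diff f + ce_diff h.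
Proof.
apply/funext => u; rewrite /ce_diff !fctE scalerDr [RHS]addrACA; congr (_ + _).
  rewrite scaler_sumr -big_split /=; apply: eq_bigr => i _.
  by rewrite !fctE lact_linearr scalerDr !scalerA mulrC.
rewrite scaler_sumr -big_split /=; apply: eq_bigr => i _.
rewrite scaler_sumr -big_split /=; apply: eq_bigr => j _.
by rewrite scalerDr !scalerA mulrC.
Qed.

Lemma inner_lieD n x y (f : ('I_n.+1 -> g) -> M) :
  inner y (lieD x f) = lieD x (inner y f) - inner (bracket x y) f.
Proof.
apply/funext => u; rewrite /inner /lieD !fctE big_ord_recl prep0 -prep_with0.
rewrite opprD addrCA addrC; congr (_ - _ - _); apply: eq_bigr => i _.
by rewrite prepS prep_with.
Qed.

(** Induction on the number of arguments: after contraction with [z], [inner_lieD] leaves the Jacobi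
    identity for [[x, y], z]. *)
Lemma lieD_bracket n x y (f : ('I_n -> g) -> M) : multilinear f ->
  lieD (bracket x y) f = lieD x (lieD y f) - lieD y (lieD x f).
Proof.
elim: n => [|n IH] in f * => fl.
  apply/funext => u; rewrite /lieD !fctE !big_ord0 !subr0.
  exact: lact_bracket.
apply: inner_ext => z; rewrite innerB !inner_lieD (lieDB x (lieD y _)) (lieDB y (lieD x _)) IH.
  have -> : inner (bracket (bracket x y) z) f
      = inner (bracket x (bracket y z)) f - inner (bracket y (bracket x z)) f.
    have := inner_linear 1 (bracket (bracket x y) z) (bracket y (bracket x z)) fl.
    by rewrite !scale1r -bracket_der => ->; rewrite addrK.
  move: (lieD x (lieD y _)) (lieD y (lieD x _)) => A B.
  move: (lieD x (inner _ f)) (lieD y (inner _ f)) => C D.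
  move: (inner (bracket x _) f) (inner (bracket y _) f) => E F.
  apply/funext => u; rewrite !fctE.
  move: (A u) (B u) (C u) (D u) (E u) (F u) => {}A {}B {}C {}D {}E {}F.
  rewrite !opprB !addrA.
  by rewrite [RHS](ACl (1*8*3*6*(5*2)*(7*4)))/= !subrr !addr0.
by move=> u i a v w; rewrite /inner !prep_with fl.
Qed.

Lemma lieD_ce_diff n x (f : ('I_n -> g) -> M) : is_cochain f ->
  lieD x (ce_diff f) = ce_diff (lieD x f).
Proof.
elim: n => [|n IH] in x f * => fc; apply: inner_ext => y.
  rewrite inner_lieD !ce_diff_0.
  apply/funext => u; rewrite /lieD !fctE !big_ord0 !subr0 lact_bracket.
  by rewrite opprB addrC subrK.
have fl := proj1 fc.
have fc' z : is_cochain (inner z f) by apply: inner_cochain.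
rewrite inner_lieD (cartan _ fc) (cartan _ fc) lieDB lieD_bracket // IH //.
rewrite (cartan _ (lieD_cochain x fc)) inner_lieD ce_diffB.
move: (lieD x (lieD y f)) (lieD y (lieD x f)) => A B.
move: (ce_diff (inner (bracket x y) f)) (ce_diff (lieD x (inner y f))) => C D.
by rewrite !opprB !addrA [LHS](ACl (4*2*3*(1*5)))/= subrr addr0 addrAC.
Qed.

(** Only repetitions that involve the first argument need a separate test; the others are seen by
    [inner x h]. *)
Lemma cochain_inner_intro n (h : ('I_n.+1 -> g) -> M) :
  (forall x, is_cochain (inner x h)) ->
  (forall a x y, inner (a *: x + y) h = a *: inner x h + inner y h) ->
  (forall x u j, u j = x -> h (prep x u) = 0) -> is_cochain h.
Proof.
move=> hc hl h0; split=> [u i a v w|u i j ij uij].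
  rewrite (prepE u); case: (unliftP ord0 i) => [k|] ->.
    by rewrite -!prep_with; apply: (proj1 (hc _)).
  rewrite -!prep_with0.
  by have := congr1 (@^~ (u \o lift ord0)) (hl a v w).
rewrite (prepE u); case: (unliftP ord0 i) => [k|] ik; last first.
  case: (unliftP ord0 j) => [l|] jl; last by rewrite ik jl eqxx in ij.
  by apply: (h0 _ _ l); rewrite /= -jl -uij ik.
case: (unliftP ord0 j) => [l|] jl; last first.
  by apply: (h0 _ _ k); rewrite /= -ik uij jl.
apply: (proj2 (hc _) _ k l); last by rewrite /= -ik -jl.
by apply: contraNneq ij => kl; rewrite ik jl kl.
Qed.

Lemma ce_diff_cochain n (f : ('I_n -> g) -> M) :
  is_cochain f -> is_cochain (ce_diff f).
Proof.
elim: n => [|n IH] in f * => fc; have fl := proj1 fc.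
  apply: cochain_inner_intro => [x|a x y|x u []//].
    by rewrite ce_diff_0 //; split=> [u []|u []].
  by rewrite !ce_diff_0 //; apply/funext => u; rewrite !fctE lact_linearl.
have dc x : is_cochain (inner x (ce_diff f)).
  rewrite cartan //; apply: is_cochainB; first exact: lieD_cochain.
  by apply: IH; apply: inner_cochain.
apply: cochain_inner_intro => // [a x y|x u j uj].
  rewrite !cartan // lieD_linear // inner_linear // ce_diff_linear.
  move: (lieD x f) (lieD y f) (ce_diff (inner x f)) => A B C.
  by rewrite scalerBr opprD addrACA.
(* The repeated argument x moves to the front, leaving i_x i_x d f. As [x, x] = 0, Cartan's formula
   applied twice reduces this to d i_x i_x f, and i_x i_x f = 0. *)
have := cochain_front j u (dc x).
suff -> : inner x (ce_diff f) (prep (u j) (u \o lift j)) = 0.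
  move/esym/eqP; rewrite scaler_eq0 signr_eq0 /= => /eqP <-; by [].
rewrite uj; set v := u \o _; rewrite -[inner _ _ _]/(inner x (inner x _) v).
rewrite cartan // innerB inner_lieD bracketxx.
have i0 (f' : ('I_n.+1 -> g) -> M) : multilinear f' -> inner 0 f' = 0.
  move=> fl'; apply/funext => w; apply: (multilinear0 (i := ord0)) => //.
  by rewrite prep0.
rewrite i0 // subr0.
case: n f fc fl IH dc u j uj v i0 => [|n] f fc fl IH dc u j uj v i0.
  rewrite ce_diff_0.
  by rewrite /lieD !fctE big_ord0 subr0 subrr.
rewrite cartan; last exact: inner_cochain.
have -> : inner x (inner x f) = 0.
  apply/funext => w; apply: (proj2 fc _ ord0 (lift ord0 ord0)) => //.
  by rewrite !(prep0, prepS).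
by rewrite ce_diff0 subr0 subrr.
Qed.

(** Cartan's formula twice gives i_x d d f = L_x d f - d L_x f + d d i_x f; the first two terms
    cancel and the last falls to induction. *)
Lemma ce_diff_diff n (f : ('I_n -> g) -> M) :
  is_cochain f -> ce_diff (ce_diff f) = 0.
Proof.
elim: n => [|n IH] in f * => fc; apply: inner_ext => x.
  rewrite cartan; last exact: ce_diff_cochain.
  rewrite lieD_ce_diff // (_ : inner x _ = lieD x f) ?subrr // ce_diff_0 //.
  by apply/funext => u; rewrite /lieD big_ord0 subr0.
rewrite cartan; last exact: ce_diff_cochain.
rewrite lieD_ce_diff // cartan // ce_diffB IH ?subr0 ?subrr //.
exact: inner_cochain.
Qed.

End Cartan.

(** * Poincare-Birkhoff-Witt theorem *)


Section Basis.
Variables (K : fieldType) (L : lmodType K).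

(** A well-order of the whole carrier; its order axioms are read off from unique minima of sets of
    two or three elements. *)
Definition wo : rel L := sval (well_ordering_principle L).

Lemma wo_total : total wo.
Proof.
move=> x y.
have [|m [[mA mm] _]] := svalP (well_ordering_principle L) (mem [:: x; y]).
  by exists x; rewrite inE eqxx.
have := mm x; have := mm y; rewrite !inE !eqxx orbT => /(_ isT) my /(_ isT) mx.
by move: mA; rewrite !inE => /orP[]/eqP mE; rewrite mE in mx my; apply/orP;
  [left|right].
Qed.

Lemma wo_antisym : antisymmetric wo.
Proof.
move=> x y /andP[xy yx].
have refl z : wo z z by have /orP[] := wo_total z z.
have [|m [_ mu]] := svalP (well_ordering_principle L) (mem [:: x; y]).
  by exists x; rewrite inE eqxx.
have mx : minimum_of wo (mem [:: x; y]) x.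
  by split=> [|z]; rewrite !inE ?eqxx // => /orP[]/eqP->.
have my : minimum_of wo (mem [:: x; y]) y.
  by split=> [|z]; rewrite !inE ?eqxx ?orbT // => /orP[]/eqP->.
by rewrite -(mu _ mx) -(mu _ my).
Qed.

Lemma wo_wf (P : L -> Prop) :
  (forall x, (forall y, y <> x -> wo y x -> P y) -> P x) -> forall x, P x.
Proof.
move=> IH x; apply: contrapT => nPx.
pose A := [pred y : L | `[< ~ P y >]].
have [|m [[mA mmin] _]] := svalP (well_ordering_principle L) A.
  by exists x; apply/asboolP.
move/asboolP: (mA); apply; apply: IH => y ym yR.
apply: contrapT => nPy; apply: ym.
have yA : y \in A by apply/asboolP.
by apply/wo_antisym/andP; split=> //; apply: mmin.
Qed.

Lemma wo_trans : transitive wo.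
Proof.
move=> y x z xy yz.
have [|m [[mA mm] _]] := svalP (well_ordering_principle L) (mem [:: x; y; z]).
  by exists x; rewrite inE eqxx.
have := mm x; have := mm y; have := mm z.
rewrite !inE !eqxx !orbT => /(_ isT) mz /(_ isT) my /(_ isT) mx.
move: mA; rewrite !inE => /or3P[]/eqP mE; rewrite {}mE in mx my mz => //.
  by have -> : x = y by apply/wo_antisym/andP.
by have <- : y = z by apply/wo_antisym/andP.
Qed.

Definition lspan (P : L -> Prop) (u : L) := exists2 s : seq (K * L),
  forall p, p \in s -> P p.2 & u = \sum_(p <- s) p.1 *: p.2.

Lemma lspan0 P : lspan P 0.
Proof. by exists [::] => //; rewrite big_nil. Qed.

Lemma lspan_lin P a u v : lspan P u -> lspan P v -> lspan P (a *: u + v).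
Proof.
move=> [s sP ->] [t tP ->]; exists ([seq (a * p.1, p.2) | p <- s] ++ t).
  by move=> p; rewrite mem_cat => /orP[/mapP[q /sP qP ->]|/tP].
rewrite big_cat big_map scaler_sumr; congr (_ + _).
by apply: eq_bigr => p _; rewrite scalerA.
Qed.

Lemma lspan_sum P (T : eqType) (s : seq T) (c : T -> K) (w : T -> L) :
  (forall i, i \in s -> c i != 0 -> P (w i)) ->
  lspan P (\sum_(i <- s) c i *: w i).
Proof.
elim: s => [|i s IH] sP; first by rewrite big_nil; apply: lspan0.
rewrite big_cons.
have sp : lspan P (\sum_(j <- s) c j *: w j).
  by apply: IH => j js; apply: sP; rewrite inE js orbT.
have [ci0|ci0] := eqVneq (c i) 0; first by rewrite ci0 scale0r add0r.
apply: lspan_lin => //; exists [:: (1, w i)]; last by rewrite big_seq1 scale1r.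
by move=> p; rewrite inE => /eqP ->; apply: sP; rewrite ?inE ?eqxx.
Qed.

Definition lower v w := w <> v /\ wo w v.

(** Greedy basis: the vectors outside the span of their predecessors. It inherits the total order
    needed to sort words. *)
Definition bas := {v : L | `[< ~ lspan (lower v) v >]}.

Definition basv (i : bas) : L := val i.

Definition ble : rel bas := fun i j => wo (val i) (val j).

Lemma ble_total : total ble.
Proof. by move=> i j; apply: wo_total. Qed.

Lemma ble_trans : transitive ble.
Proof. by move=> i j k; apply: wo_trans. Qed.

Lemma ble_antisym : antisymmetric ble.
Proof. by move=> i j /wo_antisym/val_inj. Qed.

Lemma bas_span u : exists s : seq (K * bas),
  u = \sum_(p <- s) p.1 *: basv p.2.
Proof.
elim/wo_wf: u => u IH.
have [nu|nu] := asboolP (~ lspan (lower u) u).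
  exists [:: (1, exist _ u (asboolT nu))]; by rewrite big_seq1 scale1r.
have [s sl ->] : lspan (lower u) u by apply: contrapT.
elim: s sl => [|p s IHs] sl; first by exists [::]; rewrite !big_nil.
have [|t tE] := IHs; first by move=> q qs; apply: sl; rewrite inE qs orbT.
have [pu pR] := sl p (mem_head _ _); have [r rE] := IH p.2 pu pR.
exists ([seq (p.1 * q.1, q.2) | q <- r] ++ t).
rewrite big_cons big_cat big_map -tE {1}rE scaler_sumr; congr (_ + _).
by apply: eq_bigr => q _; rewrite scalerA.
Qed.

Lemma bas_max (s : seq bas) : s != [::] ->
  exists2 m, m \in s & forall i, i \in s -> ble i m.
Proof.
elim: s => // i [|j s] IH _.
  exists i; rewrite ?inE // => k; rewrite inE => /eqP ->.
  by have /orP[] := ble_total i i.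
have [//|m ms mmax] := IH.
have [im|mi] := orP (ble_total i m).
  exists m; first by rewrite inE ms orbT.
  by move=> k; rewrite inE => /orP[/eqP->|/mmax].
exists i; first by rewrite inE eqxx.
move=> k; rewrite inE => /orP[/eqP->|/mmax km]; last exact: ble_trans mi.
by have /orP[] := ble_total i i.
Qed.

(** The largest vector with a nonzero coefficient would lie in the span of smaller ones. *)
Lemma bas_free (t : seq bas) (c : bas -> K) : uniq t ->
  \sum_(i <- t) c i *: basv i = 0 -> forall i, i \in t -> c i = 0.
Proof.
move=> ut t0 i it; apply/eqP; apply: contrapT => /negP ci.
have [|m] := @bas_max [seq j <- t | c j != 0].
  by apply/eqP => /(congr1 (fun s => i \in s)); rewrite mem_filter ci it.
rewrite mem_filter => /andP[cm mt] mmax.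
have := svalP m => /asboolP; apply.
rewrite (perm_big _ (perm_to_rem mt)) big_cons /= in t0.
have mE : sval m = \sum_(j <- rem m t) (- (c m)^-1 * c j) *: basv j.
  under eq_bigr do rewrite -scalerA; rewrite -scaler_sumr.
  move/eqP: t0; rewrite addrC addr_eq0 => /eqP ->.
  by rewrite scalerN scaleNr opprK scalerA mulVf // scale1r.
rewrite [X in lspan _ X]mE; apply: lspan_sum => j; rewrite mem_rem_uniq // inE => /andP[jm jt] cj.
have cj0 : c j != 0 by apply: contraNneq cj => ->; rewrite mulr0.
split; first by move=> jm'; move/eqP: jm; apply; exact: val_inj.
by apply: mmax; rewrite mem_filter cj0 jt.
Qed.

(** This makes linear extension from the basis independent of the chosen expansion. Since [s] may
    repeat vectors, coefficients are collected first. *)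
Lemma bas_relation (M : lmodType K) (F : bas -> M) (s : seq (K * bas)) :
  \sum_(p <- s) p.1 *: basv p.2 = 0 -> \sum_(p <- s) p.1 *: F p.2 = 0.
Proof.
pose t := undup [seq p.2 | p <- s]; pose c i := \sum_(p <- s | p.2 == i) p.1.
have sE (N : lmodType K) (G : bas -> N) :
    \sum_(p <- s) p.1 *: G p.2 = \sum_(i <- t) c i *: G i.
  under [RHS]eq_bigr do rewrite scaler_suml big_mkcond.
  rewrite exchange_big /= [LHS]big_seq [RHS]big_seq; apply: eq_bigr => p ps.
  rewrite (bigD1_seq p.2) ?undup_uniq ?eqxx //=; last first.
    by rewrite mem_undup map_f.
  rewrite big1 ?addr0 // => i.
  by rewrite eq_sym => /negPf->.
rewrite !sE => t0; rewrite big_seq big1 // => i it.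
by rewrite (bas_free (undup_uniq _) t0) ?scale0r.
Qed.

Definition bcoord (u : L) : seq (K * bas) := sval (cid (bas_span u)).

Definition blin (M : lmodType K) (F : bas -> M) (u : L) : M :=
  \sum_(p <- bcoord u) p.1 *: F p.2.

Lemma blinE (M : lmodType K) (F : bas -> M) (s : seq (K * bas)) :
  blin F (\sum_(p <- s) p.1 *: basv p.2) = \sum_(p <- s) p.1 *: F p.2.
Proof.
rewrite /blin; set u := \sum_(p <- s) _; have := svalP (cid (bas_span u)).
rewrite -/(bcoord u) => uE; apply/eqP; rewrite -subr_eq0; apply/eqP.
have sN (N : lmodType K) (G : bas -> N) :
    \sum_(p <- s) - p.1 *: G p.2 = - \sum_(p <- s) p.1 *: G p.2.
  by rewrite -sumrN; apply: eq_bigr => p _; rewrite scaleNr.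
have := @bas_relation _ F (bcoord u ++ [seq (- p.1, p.2) | p <- s]).
by rewrite !big_cat /= !big_map !sN -uE subrr => ->.
Qed.

Lemma blin_basv (M : lmodType K) (F : bas -> M) i : blin F (basv i) = F i.
Proof. by have := blinE F [:: (1, i)]; rewrite !big_seq1 !scale1r. Qed.

Lemma blin_linear (M : lmodType K) (F : bas -> M) : linear (blin F).
Proof.
move=> a u v; have [s ->] := bas_span u; have [t ->] := bas_span v.
have sZ (N : lmodType K) (G : bas -> N) :
    \sum_(p <- s) (a * p.1) *: G p.2 = a *: \sum_(p <- s) p.1 *: G p.2.
  by rewrite scaler_sumr; apply: eq_bigr => p _; rewrite scalerA.
have := blinE F ([seq (a * p.1, p.2) | p <- s] ++ t).
by rewrite !big_cat !big_map /= !sZ => ->; rewrite !blinE.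
Qed.

Lemma blin0 (M : lmodType K) (F : bas -> M) : blin F 0 = 0.
Proof.
have := blin_linear F (-1) 0 0.
by rewrite scaler0 addr0 scaleN1r addNr.
Qed.

Lemma blin_funl (M : lmodType K) a (F G : bas -> M) u :
  blin (fun i => a *: F i + G i) u = a *: blin F u + blin G u.
Proof.
rewrite /blin scaler_sumr -big_split; apply: eq_bigr => p _ /=.
by rewrite scalerDr !scalerA mulrC.
Qed.

Lemma bas_ind (P : L -> Prop) : P 0 ->
  (forall a u v, P u -> P v -> P (a *: u + v)) ->
  (forall i, P (basv i)) -> forall u, P u.
Proof.
move=> P0 Pl Pb u; have [s ->] := bas_span u.
by elim: s => [|p s IH]; rewrite ?big_nil // big_cons; apply: Pl.
Qed.

End Basis.

(** * Straightening words in an ordered basis *)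

Section WordForms.
Variables (K : fieldType) (g : lieAlgType K) (M : lmodType K).
Implicit Types (G H : seq g -> M) (v w : seq g) (s : seq (bas g)).
Implicit Types i j k l : bas g.

Definition wmultilinear G := forall w1 w2 (a : K) (x y : g),
  G (w1 ++ (a *: x + y) :: w2) = a *: G (w1 ++ x :: w2) + G (w1 ++ y :: w2).

(** [G] matters on words of length [n], [H] on length [n - 1]. They are kept apart because [pbw]
    builds each length from the preceding one. *)
Definition straightens n G H := forall w1 x y w2,
  (size w1 + (size w2).+2)%N = n ->
  G (w1 ++ x :: y :: w2) - G (w1 ++ y :: x :: w2)
  = H (w1 ++ bracket x y :: w2).

Lemma wmultilinear0 G w1 w2 : wmultilinear G -> G (w1 ++ 0 :: w2) = 0.
Proof.
move=> Gl; have := Gl w1 w2 1 0 0; rewrite !scale1r addr0.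
by move/eqP; rewrite -subr_eq0 opprD addrA subrr sub0r oppr_eq0 => /eqP.
Qed.

Lemma wmultilinearD G w1 w2 x y : wmultilinear G ->
  G (w1 ++ (x + y) :: w2) = G (w1 ++ x :: w2) + G (w1 ++ y :: w2).
Proof. by move=> Gl; have := Gl w1 w2 1 x y; rewrite !scale1r. Qed.

Lemma wmultilinearN G w1 w2 x : wmultilinear G ->
  G (w1 ++ (- x) :: w2) = - G (w1 ++ x :: w2).
Proof.
move=> Gl; apply/eqP; rewrite -addr_eq0 -wmultilinearD // addNr.
by rewrite wmultilinear0.
Qed.

Lemma wmultilinear_cons x G : wmultilinear G ->
  wmultilinear (fun w => G (x :: w)).
Proof. by move=> Gl w1; apply: (Gl (x :: w1)). Qed.

Lemma straightens_cons n x G H : straightens n.+1 G H ->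
  straightens n (fun w => G (x :: w)) (fun w => H (x :: w)).
Proof. by move=> GH w1 y z w2 n2; apply: (GH (x :: w1)); rewrite -n2. Qed.

Local Notation b := (@basv K g).
Local Notation mb := (map b).
Local Notation srt := (sort (@ble K g)).

(** Bracket terms left behind while [i] moves right past the smaller letters of a sorted word; [G]
    sees words one letter shorter than [i :: s]. *)
Fixpoint insert_corr G (i : bas g) s : M :=
  if s is j :: s' then
    if ~~ ble i j
    then G (bracket (b i) (b j) :: mb s')
         + insert_corr (fun w => G (b j :: w)) i s'
    else 0
  else 0.

(* The terms of lower length produced when a word is insertion-sorted by means
   of x y = y x + [x, y]. *)
Fixpoint sort_corr G s : M :=
  if s is i :: s' then
    sort_corr (fun w => G (b i :: w)) s' + insert_corr G i (srt s')
  else 0.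

Lemma insert_corrB G H i s :
  insert_corr (fun w => G w - H w) i s = insert_corr G i s - insert_corr H i s.
Proof.
elim: s => [|j s IH] /= in G H *; first by rewrite subr0.
case: ifP => _; last by rewrite subr0.
by rewrite IH opprD addrACA.
Qed.

Lemma sort_corrB G H s :
  sort_corr (fun w => G w - H w) s = sort_corr G s - sort_corr H s.
Proof.
elim: s => [|j s IH] /= in G H *; first by rewrite subr0.
by rewrite IH insert_corrB opprD addrACA.
Qed.

Lemma eq_insert_corr G H i s : (forall w, size w = size s -> G w = H w) ->
  insert_corr G i s = insert_corr H i s.
Proof.
elim: s => [|j s IH] //= in G H * => GH; case: ifP => _ //.
rewrite GH /= ?size_map //; congr (_ + _).
by apply: IH => w ws; apply: GH; rewrite /= ws.
Qed.

Lemma eq_sort_corr G H s : (forall w, (size w).+1 = size s -> G w = H w) ->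
  sort_corr G s = sort_corr H s.
Proof.
elim: s => [|j s IH] //= in G H * => GH; congr (_ + _).
  by apply: IH => w ws; apply: GH; rewrite /= ws.
by apply: eq_insert_corr => w ws; apply: GH; rewrite ws size_sort.
Qed.

Lemma insert_corr0 i s : insert_corr (fun=> 0) i s = 0.
Proof. by elim: s => //= j s ->; rewrite addr0 if_same. Qed.

Lemma sort_corr0 s : sort_corr (fun=> 0) s = 0.
Proof. by elim: s => //= j s ->; rewrite insert_corr0 addr0. Qed.

Lemma srt_le i s : sorted (@ble K g) (i :: s) -> srt (i :: s) = i :: s.
Proof. by apply: sorted_sort; apply: ble_trans. Qed.

Lemma sorted_rcons s i : sorted (@ble K g) (rcons s i)
  = all (fun j => ble j i) s && sorted (@ble K g) s.
Proof. by rewrite !(sorted_pairwise (@ble_trans K g)) pairwise_rcons. Qed.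

Lemma eq_srt s t : perm_eq s t -> srt s = srt t.
Proof. exact/perm_sortP/ble_antisym/ble_trans/ble_total. Qed.

Lemma srt_cons_le i j s : sorted (@ble K g) (j :: s) -> ble j i ->
  srt (i :: j :: s) = j :: srt (i :: s).
Proof.
move=> js ji; rewrite -[RHS](sorted_sort (@ble_trans K g)).
  apply: eq_srt; apply: (@perm_trans _ (j :: i :: s)).
    by rewrite -[_ :: _ :: s]/([:: i] ++ [:: j] ++ s) perm_catCA.
  by rewrite perm_cons perm_sym perm_sort.
rewrite /= path_min_sorted ?(sort_sorted (@ble_total K g)) //.
apply/allP => k; rewrite mem_sort inE => /orP[/eqP->//|ks].
by have /(order_path_min (@ble_trans K g))/allP := js; apply.
Qed.

Lemma sorted_tail i s : sorted (@ble K g) (i :: s) -> sorted (@ble K g) s.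
Proof. exact: path_sorted. Qed.

Lemma nble i j : ~~ ble i j -> ble j i.
Proof. by have /orP[->|] := ble_total i j. Qed.

Lemma insert_corrE G H i s : sorted (@ble K g) s ->
  straightens (size s).+1 G H ->
  G (mb (i :: s)) = G (mb (srt (i :: s))) + insert_corr H i s.
Proof.
elim: s => [|j s IH] in G H * => ss GH; first by rewrite /= addr0.
rewrite [insert_corr _ _ _]/=; case: (boolP (ble i j)) => [ij|/nble ji] /=.
  by rewrite srt_le /= ?ij ?addr0.
rewrite srt_cons_le // map_cons.
have := IH _ _ (sorted_tail ss) (@straightens_cons _ (b j) _ _ GH).
have := GH [::] (b i) (b j) (mb s); rewrite /= size_map => /(_ erefl).
move/eqP; rewrite subr_eq => /eqP -> ->.
by rewrite addrCA.
Qed.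

Lemma sort_corrE G H s : straightens (size s) G H ->
  G (mb s) = G (mb (srt s)) + sort_corr H s.
Proof.
elim: s => [|i s IH] in G H * => GH; first by rewrite /= addr0.
rewrite [LHS](IH _ _ (@straightens_cons _ (b i) _ _ GH)) /=.
rewrite -[_ :: mb _]/(mb (i :: srt s)) (@insert_corrE G H i (srt s)).
- rewrite addrAC addrA; congr (G _ + _ + _).
  by congr map; apply: eq_srt; rewrite perm_cons perm_sort.
- exact/sort_sorted/ble_total.
- by rewrite size_sort.
Qed.

Lemma insert_corr_min G i s : all (ble i) s -> insert_corr G i s = 0.
Proof. by case: s => //= j s /andP[-> _]. Qed.

(* The Jacobi identity is what makes straightening confluent. *)
Lemma insert_corr_jacobi G H i j s : wmultilinear H ->
  straightens (size s).+1 G H -> sorted (@ble K g) s -> ~~ ble i j ->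
  insert_corr (fun w => G (b i :: w)) j s + insert_corr G i (srt (j :: s))
  - (insert_corr (fun w => G (b j :: w)) i s + insert_corr G j (srt (i :: s)))
  = G (bracket (b i) (b j) :: mb s).
Proof.
elim: s => [|k s IH] in G H * => Hl GH ss ij; have ji := nble ij.
  by rewrite !srt_le //= ij ji /= !addr0 add0r subr0.
case: (boolP (ble j k)) => [jk|kj].
  rewrite (srt_le (i := j)) /= ?jk //= ij add0r.
  rewrite [X in _ - (_ + X)]insert_corr_min ?addr0 ?addrK //.
  apply/allP => l; rewrite mem_sort !inE => /or3P[/eqP->//|/eqP->//|ls].
  have /allP := order_path_min (@ble_trans K g) ss; move/(_ _ ls).
  exact: ble_trans.
(* Now k < j < i, so both letters pass k. The induction hypothesis is used behind the prefix [b k],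
   and the double brackets match by the Jacobi identity. *)
have kj' := nble kj.
have ki' : ble k i by apply: ble_trans ji.
have ki : ~~ ble i k.
  by apply: contra kj => ik; apply: ble_trans ji ik.
rewrite !srt_cons_le //= kj ki /=.
have sst := sorted_tail ss.
have GHc x := @straightens_cons _ (x) _ _ GH.
have := IH _ _ (wmultilinear_cons (b k) Hl) (GHc (b k)) sst ij.
have sw x y w : size w = size s ->
    G (x :: y :: w) = G (y :: x :: w) + H (bracket x y :: w).
  move=> ws; have := GH [::] x y w; rewrite /= ws => /(_ erefl) <-.
  by rewrite addrC subrK.
have swI l x y : insert_corr (fun w => G (x :: y :: w)) l s
    = insert_corr (fun w => G (y :: x :: w)) l s
      + insert_corr (fun w => H (bracket x y :: w)) l s.
  rewrite -[LHS](subrK (insert_corr (fun w => G (y :: x :: w)) l s)) addrC.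
  rewrite -insert_corrB; congr (_ + _); apply: eq_insert_corr => w ws.
  by rewrite (sw x y) // addrAC subrr add0r.
have srtE l x : G (x :: b l :: mb s) = G (x :: mb (srt (l :: s)))
    + insert_corr (fun w => H (x :: w)) l s.
  by have := @insert_corrE _ _ l _ sst (GHc x).
rewrite (swI j) (swI i) (sw (b i)) ?size_map // (sw (b j)) ?size_map //.
rewrite (sw _ (b k)) ?size_map // !srtE.
have -> : H (bracket (b i) (bracket (b j) (b k)) :: mb s)
    = H (bracket (bracket (b i) (b j)) (b k) :: mb s)
    + H (bracket (b j) (bracket (b i) (b k)) :: mb s).
  by rewrite bracket_der -(wmultilinearD [::]).
rewrite !opprD !addrA => IHs.
rewrite [LHS](ACl (5*8*12*15*3*(1*14)*(2*13)*(4*11)*(6*10)*(7*9)))/=.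
by rewrite !subrr !addr0 IHs.
Qed.

Lemma insert_corr_swap G H i j s : wmultilinear G -> wmultilinear H ->
  straightens (size s).+1 G H -> sorted (@ble K g) s ->
  insert_corr (fun w => G (b i :: w)) j s + insert_corr G i (srt (j :: s))
  - (insert_corr (fun w => G (b j :: w)) i s + insert_corr G j (srt (i :: s)))
  = G (bracket (b i) (b j) :: mb s).
Proof.
move=> Gl Hl GH ss; case: (boolP (ble i j)) => [ij|]; last first.
  exact: (insert_corr_jacobi Hl GH ss).
have [<-|ne] := eqVneq i j.
  by rewrite subrr bracketxx (wmultilinear0 [::]).
rewrite -opprB (insert_corr_jacobi Hl GH ss).
  have /= <- := wmultilinearN [::] (mb s) (bracket (b j) (b i)) Gl.
  by rewrite -bracketC.
by apply: contra ne => ji; apply/eqP/ble_antisym/andP.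
Qed.

(** Consistency condition for [pbw]: both words have the same sorted form, so the bracket must come
    entirely from the corrections. *)
Lemma sort_corr_swap G H s1 i j s2 : wmultilinear G -> wmultilinear H ->
  straightens (size s1 + size s2)%N.+1 G H ->
  sort_corr G (s1 ++ i :: j :: s2) - sort_corr G (s1 ++ j :: i :: s2)
  = G (mb s1 ++ bracket (b i) (b j) :: mb s2).
Proof.
elim: s1 => [|k s1 IH] in G H * => Gl Hl GH.
  (* [insert_corr_swap] yields the bracket in front of the sorted tail, and [sort_corrE] accounts
     for sorting that tail. *)
  have ss : sorted (@ble K g) (srt s2) by apply/sort_sorted/ble_total.
  have GHs : straightens (size (srt s2)).+1 G H by rewrite size_sort.
  have eqs l : srt (l :: s2) = srt (l :: srt s2).
    by apply: eq_srt; rewrite perm_cons perm_sym perm_sort.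
  have := insert_corr_swap i j Gl Hl GHs ss; rewrite -!eqs /= => Gij.
  have GHc := @straightens_cons _ (bracket (b i) (b j)) _ _ GH.
  rewrite (sort_corrE GHc) -Gij.
  rewrite -(eq_sort_corr (G := fun w => G (b i :: b j :: w)
    - G (b j :: b i :: w)) (H := fun w => H (bracket (b i) (b j) :: w)))
    => [|w ws]; last first.
    by apply: (GH [::]); rewrite -ws.
  rewrite sort_corrB !opprD !addrA.
  by rewrite [RHS](ACl (5*1*2*6*3*4))/=.
have kE (x y : bas g) : srt (s1 ++ x :: y :: s2)
    = srt (s1 ++ y :: x :: s2).
  apply: eq_srt; rewrite perm_cat2l.
  by rewrite -[_ :: _ :: s2]/([:: x] ++ [:: y] ++ s2) perm_catCA.
rewrite /= (kE j i) opprD addrACA subrr addr0.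
apply: (IH _ _ (wmultilinear_cons _ Gl) (wmultilinear_cons (b k) Hl)).
exact: straightens_cons.
Qed.

Lemma sort_corr_sorted G s : sorted (@ble K g) s -> sort_corr G s = 0.
Proof.
elim: s => [|i s IH] //= in G * => ss; rewrite IH ?(path_sorted ss) // add0r.
apply: insert_corr_min; apply/allP => j; rewrite mem_sort => js.
by have /allP := order_path_min (@ble_trans K g) ss; apply.
Qed.

Lemma words_ind (P : seq g -> Prop) :
  (forall w1 w2, P (w1 ++ 0 :: w2)) ->
  (forall w1 w2 a x y, P (w1 ++ x :: w2) -> P (w1 ++ y :: w2) ->
    P (w1 ++ (a *: x + y) :: w2)) ->
  (forall s, P (mb s)) -> forall w, P w.
Proof.
move=> P0 Pl Pb w; suff : forall s, P (mb s ++ w) by move/(_ [::]).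
elim: w => [|x w IH] s; first by rewrite cats0.
elim/bas_ind: x => [|a x y|i]; [exact: P0|exact: Pl|].
by have := IH (rcons s i); rewrite map_rcons cat_rcons.
Qed.

Lemma straightens_bas n G H : wmultilinear G -> wmultilinear H ->
  (forall s1 i j s2, (size s1 + (size s2).+2)%N = n ->
     G (mb s1 ++ b i :: b j :: mb s2) - G (mb s1 ++ b j :: b i :: mb s2)
     = H (mb s1 ++ bracket (b i) (b j) :: mb s2)) ->
  straightens n G H.
Proof.
move=> Gl Hl GH w1.
elim/words_ind: w1 => [l r|l r a u v IHu IHv|s1] x y w2 n2.
- by rewrite -!catA !cat_cons !wmultilinear0 // subr0.
- have sz z : size (l ++ z :: r) = size (l ++ u :: r) by rewrite !size_cat.
  move: (IHu x y w2) (IHv x y w2); rewrite !sz in n2 *.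
  move=> /(_ n2) + /(_ n2); rewrite -!catA !cat_cons !Gl !Hl => <- <-.
  by rewrite scalerBr opprD addrACA.
elim/bas_ind: x => [|a u v IHu IHv|i].
- have := wmultilinear0 (mb s1 ++ [:: y]) w2 Gl; rewrite -catA /= => ->.
  have -> : bracket 0 y = 0 by rewrite bracketC raddf0 oppr0.
  by rewrite !wmultilinear0 // subr0.
- rewrite bracket_linearl Hl -IHu -IHv Gl.
  have := Gl (mb s1 ++ [:: y]) w2 a u v; rewrite -!catA /= => ->.
  by rewrite scalerBr opprD addrACA.
elim/bas_ind: y => [|a u v IHu IHv|j].
- have := wmultilinear0 (mb s1 ++ [:: b i]) w2 Gl; rewrite -catA /= => ->.
  by rewrite raddf0 !wmultilinear0 // subr0.
- rewrite bracket_linearr Hl -IHu -IHv Gl.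
  have := Gl (mb s1 ++ [:: b i]) w2 a u v; rewrite -!catA /= => ->.
  by rewrite scalerBr opprD addrACA.
elim/words_ind: w2 n2 => [l r|l r a u v IHu IHv|s2] n2; last first.
- by apply: GH; rewrite size_map in n2 *; rewrite size_map in n2.
- have sz z : size (l ++ z :: r) = size (l ++ u :: r) by rewrite !size_cat.
  move: IHu IHv; rewrite !sz in n2 * => /(_ n2) IHu /(_ n2) IHv.
  have e x y z : mb s1 ++ x :: y :: l ++ z :: r
    = (mb s1 ++ x :: y :: l) ++ z :: r by rewrite -catA.
  have e' x z : mb s1 ++ x :: l ++ z :: r
    = (mb s1 ++ x :: l) ++ z :: r by rewrite -catA.
  rewrite !e e' !Gl Hl -!e -!e' -IHu -IHv.
  by rewrite scalerBr opprD addrACA.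
- have e x y z : mb s1 ++ x :: y :: l ++ z :: r
    = (mb s1 ++ x :: y :: l) ++ z :: r by rewrite -catA.
  have e' x z : mb s1 ++ x :: l ++ z :: r
    = (mb s1 ++ x :: l) ++ z :: r by rewrite -catA.
  by rewrite !e e' !wmultilinear0 // subr0.
Qed.

Fixpoint wextend (F : seq (bas g) -> M) (w : seq g) : M :=
  if w is x :: w' then blin (fun i => wextend (fun s => F (i :: s)) w') x
  else F [::].

Lemma wextendE F s : wextend F (mb s) = F s.
Proof. by elim: s F => [|i s IH] F //=; rewrite blin_basv IH. Qed.

Lemma wextend_multilinear F : wmultilinear (wextend F).
Proof.
move=> w1 w2 a x y; elim: w1 F => [|z w1 IH] F /=; first exact: blin_linear.
by rewrite -blin_funl; congr blin; apply/funext => i; rewrite IH.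
Qed.

Definition coind (F : seq g -> M) : Prop :=
  wmultilinear F /\ forall n, straightens n F F.

(* [pbw F n] is meant for words of length n. *)
Fixpoint pbw (F : seq (bas g) -> M) n : seq g -> M :=
  if n is m.+1 then wextend (fun s => F (srt s) + sort_corr (pbw F m) s)
  else wextend F.

Lemma pbw_straightens F n : straightens n.+1 (pbw F n.+1) (pbw F n).
Proof.
have pl m : wmultilinear (pbw F m) by case: m => [|m]; apply: wextend_multilinear.
elim: n => [|n IH] //.
  by move=> w1 x y w2 /eqP; rewrite !addnS eqSS.
apply: straightens_bas => // s1 i j s2 n2.
have cE x y : mb s1 ++ b x :: b y :: mb s2 = mb (s1 ++ x :: y :: s2).
  by rewrite map_cat.
have pS : pbw F n.+2 = wextend (fun s => F (srt s) + sort_corr (pbw F n.+1) s).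
  by [].
rewrite !cE pS !wextendE opprD addrACA.
have -> : srt (s1 ++ i :: j :: s2) = srt (s1 ++ j :: i :: s2).
  apply: eq_srt; rewrite perm_cat2l.
  by rewrite -[_ :: _ :: s2]/([:: i] ++ [:: j] ++ s2) perm_catCA.
rewrite subrr add0r; apply: (sort_corr_swap _ _ (pl _) (pl n)).
by move: n2; rewrite !addnS => -[->].
Qed.

(** Dual form of the linear independence of sorted monomials in U(g). On a sorted word the
    corrections vanish and [pbw] returns [F]. *)
Lemma coind_extension (F : seq (bas g) -> M) :
  exists2 G, coind G & forall s, sorted (@ble K g) s -> G (mb s) = F s.
Proof.
exists (fun w => pbw F (size w) w).
  split=> [w1 w2 a x y|n w1 x y w2 _]; rewrite !size_cat /= !addnS.
    by case: (_ + _)%N => [|m] /=; rewrite wextend_multilinear.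
  by rewrite pbw_straightens // !addnS.
move=> s ss; case: s ss => [|i s] ss //=.
rewrite size_map (blin_basv (fun i => _)) wextendE.
rewrite (sorted_sort (@ble_trans K g)) //.
by rewrite -[X in _ + X]/(sort_corr (pbw F (size s)) (i :: s)) sort_corr_sorted ?addr0.
Qed.

Lemma coind_rcons x F : coind F -> coind (fun w => F (rcons w x)).
Proof.
move=> [Fl Fs]; split=> [w1 w2 a u v|n w1 u v w2 n2].
  by rewrite !rcons_cat !rcons_cons Fl.
rewrite !rcons_cat !rcons_cons (Fs n.+1) //.
by rewrite size_rcons -n2 !addnS.
Qed.

(** Passage to the associated graded algebra S(g): corrections live one length below, so a form
    vanishing there is symmetric. *)
Lemma coind_sort F s : coind F -> (forall w, (size w).+1 = size s -> F w = 0) ->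
  F (mb s) = F (mb (srt s)).
Proof.
move=> [Fl Fs] F0; rewrite (sort_corrE (Fs (size s))).
by rewrite (eq_sort_corr (H := fun=> 0)) // sort_corr0 addr0.
Qed.

(** Dual form of the spanning half of Poincare-Birkhoff-Witt, filtered by length. *)
Lemma coind_eq0 F n : coind F ->
  (forall s, sorted (@ble K g) s -> (size s <= n)%N -> F (mb s) = 0) ->
  forall w, (size w <= n)%N -> F w = 0.
Proof.
move=> Fc; elim: n => [|n IH] F0 w wn.
  by move: wn; case: w => // _; apply: (F0 [::]).
move: wn; rewrite leq_eqVlt => /orP[/eqP wn|]; last first.
  by rewrite ltnS; apply: IH => s ss sn; apply: F0 => //; apply: leqW.
elim/words_ind: w wn => [w1 w2|w1 w2 a x y IHx IHy|s] wn.
- by rewrite wmultilinear0 //; case: Fc.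
- rewrite (proj1 Fc) IHx ?IHy ?scaler0 ?addr0 //; move: wn; rewrite !size_cat //.
rewrite size_map in wn; rewrite coind_sort // => [|w ws].
  by apply: F0; rewrite ?size_sort ?wn //; apply/sort_sorted/ble_total.
apply: IH => [t ts tn|]; first by apply: F0 => //; apply: leqW.
by move: ws; rewrite wn => -[->].
Qed.

End WordForms.

(** * Coinduced modules *)


Section Coinduced.
Variables (K : fieldType) (g : lieAlgType K) (M : lieModType g).

Definition coindb : {pred seq g -> M} := fun F => `[< coind F >].

Lemma coindb_submod_closed : submod_closed coindb.
Proof.
split=> [|a F G /asboolP[Fl Fs] /asboolP[Gl Gs]]; apply/asboolP; split.
- by move=> w1 w2 a x y; rewrite [RHS]addr0 [RHS]scaler0.
- by move=> n w1 x y w2 _; apply: subr0.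
- by move=> w1 w2 c x y; rewrite !fctE Fl Gl !scalerDr !scalerA mulrC addrACA.
- move=> n w1 x y w2 n2; rewrite !fctE -(Fs n) // -(Gs n) //.
  by rewrite opprD addrACA scalerBr.
Qed.

HB.instance Definition _ :=
  GRing.isSubmodClosed.Build K (seq g -> M) coindb coindb_submod_closed.

Record coindMod := CoindMod {
  coind_fun :> seq g -> M;
  _ : coind_fun \in coindb
}.

HB.instance Definition _ := [isSub for coind_fun].
HB.instance Definition _ := [Choice of coindMod by <:].
HB.instance Definition _ := [SubChoice_isSubLmodule of coindMod by <:].

Lemma coindModP (F : coindMod) : coind F.
Proof. exact/asboolP/(valP F). Qed.

Definition mkCoind (F : seq g -> M) (Fc : coind F) : coindMod :=
  CoindMod (asboolT Fc : F \in coindb).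

Lemma coindMod_ext (F G : coindMod) : (F =1 G) -> F = G.
Proof. by move=> FG; apply/val_inj/funext. Qed.

Lemma coindMod_linE a (F G : coindMod) w :
  (a *: F + G : coindMod) w = a *: F w + G w.
Proof. by []. Qed.

Lemma coindModBE (F G : coindMod) w : (F - G : coindMod) w = F w - G w.
Proof. by []. Qed.

Lemma coindMod_sumE (I : Type) (r : seq I) (P : pred I) (F : I -> coindMod) w :
  (\sum_(i <- r | P i) F i : coindMod) w = \sum_(i <- r | P i) F i w.
Proof. by elim/big_rec2: _ => // i x y _ <-. Qed.

(** Right translation on Hom_K(U(g), M); the action on [M] enters through [coind_embed]. *)
Definition coind_act x (F : coindMod) : coindMod := mkCoind (coind_rcons x (coindModP F)).

Lemma coind_act_linearl a x y (F : coindMod) :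
  coind_act (a *: x + y) F = a *: coind_act x F + coind_act y F.
Proof.
apply: coindMod_ext => w; rewrite coindMod_linE /= -!cats1.
by rewrite (proj1 (coindModP F)).
Qed.

Lemma coind_act_linearr a x (F G : coindMod) :
  coind_act x (a *: F + G) = a *: coind_act x F + coind_act x G.
Proof. exact: coindMod_ext. Qed.

Lemma coind_act_bracket x y (F : coindMod) :
  coind_act (bracket x y) F
  = coind_act x (coind_act y F) - coind_act y (coind_act x F).
Proof.
apply: coindMod_ext => w; rewrite coindModBE /= -!cats1 -!catA /=.
by rewrite (proj2 (coindModP F) _ w x y [::] erefl).
Qed.

HB.instance Definition _ := isLieModule.Build K g coindMod
  coind_act_linearl coind_act_linearr coind_act_bracket.

Lemma coind_lactE x (F : coindMod) w : (lact x F : coindMod) w = F (rcons w x).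
Proof. by []. Qed.

Local Notation b := (@basv K g).
Local Notation mb := (map b).
Local Notation srt := (sort (@ble K g)).

Lemma coindMod_eqP (F G : coindMod) :
  (forall s, sorted (@ble K g) s -> F (mb s) = G (mb s)) -> F = G.
Proof.
move=> FG; apply: coindMod_ext => w; apply/eqP; rewrite -subr_eq0 -coindModBE.
apply/eqP/(coind_eq0 (coindModP (F - G)) (n := size w)) => // s ss _.
by rewrite coindModBE FG ?subrr.
Qed.

Lemma ce_diff_coindE n (f : ('I_n -> g) -> coindMod) u w :
  ce_diff f u w
  = \sum_(i < n.+1) (-1) ^+ i *: f (u \o lift i) (rcons w (u i))
    + \sum_(i < n.+1) \sum_(j < n.+1 | (i < j)%N)
        (-1) ^+ (i + j) *: f (contract u i j) w.
Proof.
rewrite /ce_diff -[LHS]/(coind_fun (_ : coindMod) w + coind_fun (_ : coindMod) w).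
rewrite !coindMod_sumE; congr (_ + _); apply: eq_bigr => i _.
by rewrite coindMod_sumE.
Qed.

Lemma coind_eval_cochain n (f : ('I_n -> g) -> coindMod) w :
  is_cochain f -> is_cochain (fun u => f u w : M).
Proof.
move=> [fl fa]; split=> [u i a x y|u i j ij uij].
  by rewrite fl coindMod_linE.
by rewrite (fa _ _ _ ij uij).
Qed.

Lemma linear_blin (N N' : lmodType K) (h : N -> N') (F : bas g -> N) x :
  linear h -> h (blin F x) = blin (fun j => h (F j)) x.
Proof.
move=> hl; elim/bas_ind: x => [|a x y IHx IHy|i].
- rewrite !blin0; have := hl (-1) 0 0.
  by rewrite scaler0 addr0 scaleN1r addNr.
- by rewrite !blin_linear hl IHx IHy.
- by rewrite !blin_basv.
Qed.

Lemma coind_rcons_blin (F : coindMod) w (G : bas g -> g) x :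
  F (rcons w (blin G x)) = blin (fun j => F (rcons w (G j))) x.
Proof.
apply: (linear_blin (h := fun y => F (rcons w y))) => a y z.
by rewrite -!cats1 (proj1 (coindModP F)).
Qed.

Definition truncate (P : pred (bas g)) : g -> g :=
  blin (fun j => if P j then b j else 0).

Lemma truncate_linear P : linear (truncate P).
Proof. exact: blin_linear. Qed.

Lemma truncateE P j : truncate P (b j) = if P j then b j else 0.
Proof. exact: blin_basv. Qed.

Definition lessthan (a : bas g) : pred (bas g) := fun j => ~~ ble a j.

Lemma comp_with (h : g -> g) n (u : 'I_n -> g) i x :
  h \o [eta u with i |-> x] = [eta h \o u with i |-> h x].
Proof. by apply/funext => k /=; case: eqP. Qed.

Lemma multilinear_bas_ext n (F G : ('I_n -> g) -> M) :
  multilinear F -> multilinear G ->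
  (forall t : 'I_n -> bas g, F (b \o t) = G (b \o t)) -> F = G.
Proof.
elim: n => [|n IH] in F G * => Fl Gl FG.
  apply/funext => u.
  have := FG (fun i => False_rect _ (notF (ltn_ord i))).
  by congr (_ = _); congr (_ _); apply/funext; case.
apply: inner_ext => x.
have il (H : ('I_n.+1 -> g) -> M) y : multilinear H -> multilinear (inner y H).
  by move=> Hl u i a v w; rewrite /inner !prep_with Hl.
elim/bas_ind: x => [|a x y IHx IHy|j].
- by apply/funext => u; rewrite /inner !(multilinear0 (i := ord0)) ?prep0.
- by rewrite !inner_linear // IHx IHy.
apply: IH; [exact: il|exact: il|] => t; rewrite /inner.
by have := FG (prep j t); rewrite prep_comp.
Qed.

(* Expansion of an alternating form along the largest basis vector that occurs
   among its arguments. *)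
Lemma alternating_expand n (F : ('I_n.+1 -> g) -> M) (P : pred (bas g)) u :
  is_cochain F -> (forall i j, P i -> ble i j -> P j) ->
  F u = F (truncate (predC P) \o u)
    + \sum_(i < n.+1) (-1) ^+ i *:
        blin (fun j => if P j
          then F (prep (b j) (truncate (lessthan j) \o (u \o lift i)))
          else 0) (u i).
Proof.
move=> Fc Pup; have [Fl Fa] := Fc.
pose T (i : 'I_n.+1) (u : 'I_n.+1 -> g) := blin (fun j => if P j
  then F (prep (b j) (truncate (lessthan j) \o (u \o lift i))) else 0) (u i).
suff /(congr1 (@^~ u)) : F = fun u => F (truncate (predC P) \o u)
    + \sum_(i < n.+1) (-1) ^+ i *: T i u by [].
have Tl i : multilinear (T i).
  move=> v l a x y; rewrite /T.
  case: (unliftP i l) => [k|] ->; last first.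
    by rewrite !with_lift_self /= eqxx blin_linear.
  rewrite /= (negPf (neq_lift i k)) -blin_funl; congr blin.
  apply/funext => j; case: ifP => _; last by rewrite scaler0 addr0.
  by rewrite !with_lift !comp_with truncate_linear !prep_with Fl.
apply: multilinear_bas_ext => // [v l a x y|t].
  rewrite !comp_with truncate_linear Fl scalerDr [RHS]addrACA; congr (_ + _).
  rewrite scaler_sumr -big_split; apply: eq_bigr => i _ /=.
  by rewrite Tl scalerDr !scalerA mulrC.
have [/forallP nP|/forallPn[i0 /negPn Pi0]] := boolP [forall i, ~~ P (t i)].
  rewrite big1 ?addr0 => [|i _].
    by congr F; apply/funext => i /=; rewrite truncateE /= nP.
  by rewrite /T /= blin_basv (negPf (nP i)) scaler0.
(* Let [t m] be the largest argument. Each summand other than [m] still contains [t m], which its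
   truncation kills. *)
have [|j /codomP[m ->] mmax] := @bas_max _ _ (codom t).
  by apply/eqP => /(congr1 (fun s => t i0 \in s)); rewrite codom_f.
have {}mmax i : ble (t i) (t m) by apply/mmax/codom_f.
have Pm : P (t m) by apply: Pup (mmax i0).
rewrite [F (truncate _ \o _)](multilinear0 (i := m)) //=; last first.
  by rewrite truncateE /= Pm.
rewrite add0r (bigD1 m) //= big1 ?addr0 => [|i im]; last first.
  rewrite /T /= blin_basv; case: ifP => _; last by rewrite scaler0.
  case: (unliftP i m) => [k mE|mE]; last by rewrite mE eqxx in im.
  rewrite (multilinear0 (i := lift ord0 k)) ?scaler0 // prepS /= -mE.
  by rewrite truncateE /lessthan mmax.
rewrite /T /= blin_basv Pm.
(* If the maximum is attained twice, [F] vanishes by alternation and the summand by truncation;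
   otherwise truncation changes nothing. *)
have [/existsP[k mk]|/existsPn mlt] := boolP [exists k, ble (t m) (t (lift m k))].
  have mkE : t m = t (lift m k) by apply/ble_antisym/andP.
  rewrite (Fa _ m (lift m k)) ?neq_lift //= -?mkE //.
  rewrite (multilinear0 (i := lift ord0 k)) ?scaler0 // prepS /=.
  by rewrite truncateE /lessthan mk.
have -> : truncate (lessthan (t m)) \o (b \o t \o lift m) = b \o t \o lift m.
  by apply/funext => k /=; rewrite truncateE /lessthan mlt.
rewrite (cochain_front m (b \o t)) // scalerA -signr_odd -signr_addb addbb.
by rewrite scale1r.
Qed.

(** The last letter of a sorted word is its largest. It becomes the first argument of [c], and the
    truncation keeps only arguments strictly below it. Only words of length [k + 1] count. *)
Definition homot_val k n (c : ('I_n.+1 -> g) -> coindMod) (u : 'I_n -> g)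
    (s : seq (bas g)) : M :=
  if s is i :: t then
    if size t == k
    then c (prep (b (last i t)) (truncate (lessthan (last i t)) \o u))
           (mb (belast i t))
    else 0
  else 0.

Lemma homot_val_rcons k n (c : ('I_n.+1 -> g) -> coindMod) u s a :
  homot_val k c u (rcons s a) = if size s == k
    then c (prep (b a) (truncate (lessthan a) \o u)) (mb s) else 0.
Proof. by case: s => [|i s] //=; rewrite size_rcons last_rcons belast_rcons. Qed.

(* The Koszul contraction, transported to words through the normal form of
   coind_extension; it inverts the part of ce_diff that raises the length of
   words. *)
Definition homot k n (c : ('I_n.+1 -> g) -> coindMod) (u : 'I_n -> g) :
    coindMod :=
  let: exist2 _ Gc _ := cid2 (coind_extension (homot_val k c u)) in mkCoind Gc.

Lemma homotE k n (c : ('I_n.+1 -> g) -> coindMod) u s :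
  sorted (@ble K g) s -> homot k c u (mb s) = homot_val k c u s.
Proof. by rewrite /homot; case: cid2 => G Gc GE /=; apply: GE. Qed.

Lemma homot_cochain k n (c : ('I_n.+1 -> g) -> coindMod) :
  is_cochain c -> is_cochain (homot k c).
Proof.
move=> [cl ca]; split=> [u i a x y|u i j ij uij]; apply: coindMod_eqP => s ss.
  rewrite coindMod_linE !homotE //; case: s ss => [|l s] _ /=.
    by rewrite scaler0 addr0.
  case: ifP => _; last by rewrite scaler0 addr0.
  by rewrite !comp_with truncate_linear !prep_with cl.
rewrite homotE //; case: s ss => [|l s] _ //=; case: ifP => _ //.
rewrite (ca _ (lift ord0 i) (lift ord0 j)) // ?(inj_eq lift_inj) //.
by rewrite !prepS /= uij.
Qed.

Definition vanishes_below k n (c : ('I_n -> g) -> coindMod) :=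
  forall u w, (size w < k)%N -> c u w = 0.

Lemma homot_small k n (c : ('I_n.+1 -> g) -> coindMod) :
  vanishes_below k.+1 (homot k c).
Proof.
move=> u; apply: coind_eq0 (coindModP _) _ => s ss sk; rewrite homotE //.
by case: s ss sk => [|i s] _ //= sk; rewrite ltn_eqF.
Qed.

Lemma homot_step k n (c : ('I_n.+1 -> g) -> coindMod) : is_cocycle c ->
  vanishes_below k c -> vanishes_below k.+1 (c - ce_diff (homot k c)).
Proof.
move=> [cc dc] ck u; apply: coind_eq0 (coindModP _) _ => s ss sk.
(* Bracket terms keep the word, of length at most [k], where [homot] vanishes; action terms append a
   letter. *)
rewrite coindModBE ce_diff_coindE [X in _ - (_ + X)]big1 => [|i _]; last first.
  by apply: big1 => j _; rewrite homot_small ?scaler0 // size_map.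
rewrite addr0; move: sk; rewrite leq_eqVlt => /orP[/eqP sk|sk]; last first.
  rewrite ck ?size_map // big1 ?subrr // => i _.
  by rewrite homot_small ?scaler0 // size_rcons size_map.
pose F u := c u (mb s).
have Fc : is_cochain F by apply: coind_eval_cochain.
(* In length [k + 1] the homotopy is symmetric, since it vanishes in length [k]. *)
have hE v x : homot k c v (rcons (mb s) x)
    = blin (fun j => homot_val k c v (srt (rcons s j))) x.
  elim/bas_ind: x => [|a x y IHx IHy|j].
  - rewrite -cats1 (wmultilinear0 _ _ (proj1 (coindModP _))).
    by rewrite blin0.
  - by rewrite -cats1 (proj1 (coindModP _)) !cats1 IHx IHy blin_linear.
  rewrite blin_basv -map_rcons coind_sort ?homotE //.
  - exact/sort_sorted/ble_total.
  - exact: coindModP.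
  - by move=> w; rewrite size_rcons sk => -[wk]; rewrite homot_small // wk.
under eq_bigr do rewrite hE.
have [s0|[t [a st]]] : s = [::] \/ exists t a, s = rcons t a.
- by case/lastP: s {ss sk F Fc hE} => [|t a]; [left|right; exists t, a].
- apply/eqP; rewrite subr_eq0; apply/eqP.
  rewrite -[LHS]/(F u) (alternating_expand u Fc (P := predT)) //.
  rewrite (multilinear0 (i := ord0)) ?add0r; last 2 first.
  + exact: (proj1 Fc).
  + rewrite /= /truncate; elim/bas_ind: (u ord0) => [|e x y IHx IHy|j].
    * by rewrite blin0.
    * by rewrite blin_linear IHx IHy scaler0 addr0.
    * by rewrite blin_basv.
  apply: eq_bigr => i _; congr (_ *: blin _ _); apply/funext => j /=.
  by rewrite s0 /= -sk s0 eqxx /F s0.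
have tk : (size t).+1 = k by rewrite -sk st size_rcons.
have ta : forall j, j \in t -> ble j a.
  by move: ss; rewrite st sorted_rcons => /andP[/allP].
set v := truncate (lessthan a) \o u.
(* The cocycle identity at [t], one letter shorter than [s], computes the part of the expansion
   whose arguments all lie below [a]; bracket terms vanish because [t] has length below [k]. *)
have : ce_diff c (prep (b a) v) (mb t) = 0 by rewrite dc.
rewrite ce_diff_coindE [X in _ + X = _ -> _]big1 => [|i _]; last first.
  by apply: big1 => j _; rewrite ck ?scaler0 // size_map tk.
rewrite addr0 big_ord_recl expr0 scale1r prep0 prep_lift0 => /eqP.
rewrite addr_eq0 -map_rcons -st => /eqP cv.
apply/eqP; rewrite subr_eq0; apply/eqP.
rewrite -[LHS]/(F u) (alternating_expand u Fc (P := ble a)); last first.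
  by move=> i j; apply: ble_trans.
rewrite [F _]cv -sumrN -big_split; apply: eq_bigr => i _ /=.
rewrite prepS prep_lift /bump leq0n add1n exprS mulN1r scaleNr opprK -scalerDr.
congr (_ *: _); rewrite coind_rcons_blin -[blin _ _ as X in X + _]scale1r.
rewrite -blin_funl; congr blin; apply/funext => j; rewrite scale1r /lessthan.
(* For j at or above [a] the homotopy extracts j, matching the expansion; below [a] it extracts [a],
   matching the cocycle identity. *)
have [aj|/negPf aj] := boolP (ble a j) => /=.
  have sj : sorted (@ble K g) (rcons s j).
    rewrite sorted_rcons ss andbT; apply/allP => l; rewrite st mem_rcons inE.
    by move=> /orP[/eqP->//|/ta la]; apply: ble_trans aj.
  rewrite (sorted_sort (@ble_trans K g)) // homot_val_rcons sk eqxx.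
  by rewrite -cats1 (wmultilinear0 _ _ (proj1 (coindModP _))) add0r.
have ja : ble j a by apply: nble; rewrite aj.
have -> : srt (rcons s j) = rcons (srt (rcons t j)) a.
  rewrite -[RHS](sorted_sort (@ble_trans K g)).
    apply: eq_srt; apply/seq.permP => p; rewrite st -!cats1 !count_cat.
    by rewrite (seq.permP (permEl (perm_sort _ _))) count_cat addnAC.
  rewrite sorted_rcons (sort_sorted (@ble_total K g)) andbT; apply/allP => l.
  by rewrite mem_sort mem_rcons inE => /orP[/eqP->//|/ta].
rewrite homot_val_rcons size_sort size_rcons tk eqxx addr0 -map_rcons.
apply: coind_sort; first exact: coindModP.
by move=> w; rewrite size_rcons => -[wt]; apply: ck; rewrite wt -tk.
Qed.

(** * Summing the contractions over all lengths *)

Section Acyclic.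
Variables (n : nat) (c : ('I_n.+1 -> g) -> coindMod).
Variable cP : is_cocycle c.

Fixpoint residue k : ('I_n.+1 -> g) -> coindMod :=
  if k is m.+1 then residue m - ce_diff (homot m (residue m)) else c.

Definition partial k u : coindMod := \sum_(m < k) homot m (residue m) u.

Lemma residueP k : is_cocycle (residue k) /\ vanishes_below k (residue k).
Proof.
elim: k => [|k [kc kb]] //=.
have hc : is_cochain (homot k (residue k)) by apply/homot_cochain/(proj1 kc).
split; last exact: homot_step.
case: kc => kc dk; split; first by apply/is_cochainB/ce_diff_cochain.
by rewrite ce_diffB dk ce_diff_diff // subrr.
Qed.

Lemma partialS k : partial k.+1 = partial k + homot k (residue k).
Proof. by apply/funext => u; rewrite /partial big_ord_recr. Qed.

Lemma partial_cochain k : is_cochain (partial k).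
Proof.
elim: k => [|k IH].
  have -> : partial 0 = 0 by apply/funext => u; rewrite /partial big_ord0.
  exact: is_cochain0.
rewrite partialS -[X in _ + X]opprK; apply: is_cochainB => //.
rewrite -sub0r; apply: is_cochainB; first exact: is_cochain0.
by apply: homot_cochain; have [[]] := residueP k.
Qed.

Lemma residueE k : residue k = c - ce_diff (partial k).
Proof.
elim: k => [|k IH].
  have -> : partial 0 = 0 by apply/funext => u; rewrite /partial big_ord0.
  by rewrite ce_diff0 subr0.
rewrite partialS [partial k + _]addrC -[homot _ _]scale1r ce_diff_linear.
rewrite scale1r [LHS]/=; move: (ce_diff (homot _ _)) => A; rewrite IH.
by move: (ce_diff (partial k)) => B; rewrite opprD addrA addrAC.
Qed.

(** [homot l] vanishes on words of length at most [l], so the sum of all homotopies is finite on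
    each word. *)
Lemma partial_stable k l u w : (size w <= k)%N -> (k <= l)%N ->
  partial l u w = partial k u w.
Proof.
move=> wk; elim: l => [|l IH]; first by rewrite leqn0 => /eqP ->.
rewrite leq_eqVlt => /orP[/eqP->//|kl]; rewrite partialS.
rewrite -[LHS]/(partial l u w + homot l (residue l) u w) IH //.
by rewrite homot_small ?addr0 // ltnS (leq_trans wk).
Qed.

Definition primitive_fun u w : M := partial (size w) u w.

Lemma primitive_funE k u w : (size w <= k)%N -> primitive_fun u w = partial k u w.
Proof. by move=> wk; apply/esym/partial_stable. Qed.

Lemma primitive_coind u : coind (primitive_fun u).
Proof.
split=> [w1 w2 a x y|m w1 x y w2 m2].
  rewrite !(primitive_funE (k := size (w1 ++ x :: w2))) ?size_cat //.
  exact: (proj1 (coindModP _)).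
rewrite !(primitive_funE (k := m)); last 3 first.
- by rewrite -m2 size_cat /= leq_add2l.
- by rewrite -m2 size_cat.
- by rewrite -m2 size_cat.
exact: (proj2 (coindModP (partial m u))).
Qed.

Definition primitive u : coindMod := mkCoind (primitive_coind u).

Lemma primitive_cochain : is_cochain primitive.
Proof.
split=> [u i a x y|u i j ij uij]; apply: coindMod_ext => w.
  rewrite coindMod_linE; have [pl _] := partial_cochain (size w).
  exact: (congr1 (fun F : coindMod => F w) (pl u i a x y)).
have [_ pa] := partial_cochain (size w).
exact: (congr1 (fun F : coindMod => F w) (pa u i j ij uij)).
Qed.

Lemma primitiveE : c = ce_diff primitive.
Proof.
apply/funext => u; apply: coindMod_ext => w.
(* One more step than [size w]: the action terms of the differential evaluate the primitive on words
   one letter longer. *)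
have := proj2 (residueP (size w).+1) u w (ltnSn _).
rewrite residueE coindModBE => /eqP; rewrite subr_eq0 => /eqP ->.
rewrite !ce_diff_coindE; congr (_ + _).
  apply: eq_bigr => i _; congr (_ *: _).
  by symmetry; apply: primitive_funE; rewrite size_rcons.
apply: eq_bigr => i _; apply: eq_bigr => j _; congr (_ *: _).
by symmetry; apply: primitive_funE.
Qed.

End Acyclic.

Lemma coind_acyclic n (c : ('I_n.+1 -> g) -> coindMod) :
  is_cocycle c -> is_coboundary c.
Proof.
move=> cP; exists (primitive c); last exact: primitiveE.
exact: primitive_cochain.
Qed.

Lemma coind_embed_coind (m : M) : coind (foldr (@lact K g M) m).
Proof.
split=> [w1 w2 a x y|n w1 x y w2 _]; rewrite !foldr_cat.
  elim: w1 => [|z w1 IH] /=; first exact: lact_linearl.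
  by rewrite IH lact_linearr.
elim: w1 => [|z w1 IH] /=; first by rewrite lact_bracket.
by rewrite -lact_sub IH.
Qed.

(** Unit of coinduction; evaluation at [[::]] is a linear retraction of it. *)
Definition coind_embed (m : M) : coindMod := mkCoind (coind_embed_coind m).

Lemma coind_embed_linear : linear coind_embed.
Proof.
move=> a m m'; apply: coindMod_ext => w; rewrite coindMod_linE /=.
by elim: w => [|z w IH] //=; rewrite IH lact_linearr.
Qed.

HB.instance Definition _ := GRing.isLinear.Build K M coindMod *:%R coind_embed
  coind_embed_linear.

Lemma coind_embed_lact x m : coind_embed (lact x m) = lact x (coind_embed m).
Proof. by apply: coindMod_ext => w; rewrite coind_lactE /= foldr_rcons. Qed.

End Coinduced.

(* The action e x e makes the carrier a module both when ker e and when im e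
   is a submodule (e idempotent): it encodes quotients and submodules without
   changing the type. *)
Section Corner.
Variables (K : fieldType) (g : lieAlgType K) (M : lieModType g).
Variable e : {linear M -> M}.

Definition corner_compat := forall (x y : g) (m : M),
  e (lact x (e (e (lact y (e m))))) = e (lact x (lact y (e m))).

Definition corner (_ : corner_compat) : Type := M.

Variable eP : corner_compat.

HB.instance Definition _ := GRing.Lmodule.on (corner eP).

Definition corner_act (x : g) (m : corner eP) : corner eP :=
  e (lact x (e m)).

Lemma corner_act_linearl a x y (m : corner eP) :
  corner_act (a *: x + y) m = a *: corner_act x m + corner_act y m.
Proof. by rewrite /corner_act lact_linearl linearP. Qed.

Lemma corner_act_linearr a x (m n : corner eP) :
  corner_act x (a *: m + n) = a *: corner_act x m + corner_act x n.
Proof. by rewrite /corner_act !linearP. Qed.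

Lemma corner_act_bracket x y (m : corner eP) :
  corner_act (bracket x y) m
  = corner_act x (corner_act y m) - corner_act y (corner_act x m).
Proof. by rewrite /corner_act lact_bracket linearB !eP. Qed.

HB.instance Definition _ := isLieModule.Build K g (corner eP)
  corner_act_linearl corner_act_linearr corner_act_bracket.

End Corner.

(** * Free Lie algebras in degrees at least two *)


Definition acyclic (K : fieldType) (g : lieAlgType K) n :=
  forall (M : lieModType g) (f : ('I_n -> g) -> M),
  is_cocycle f -> is_coboundary f.

Section Shift.
Variables (K : fieldType) (g : lieAlgType K).

Lemma ce_diff_map (M N : lieModType g) (h : M -> N) n (f : ('I_n -> g) -> M) :
  linear h -> (forall x m, h (lact x m) = lact x (h m)) ->
  ce_diff (h \o f) = h \o ce_diff f.
Proof.
move=> hl hx; have h0 : h 0 = 0.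
  by have := hl (-1) 0 0; rewrite scaler0 addr0 scaleN1r addNr.
have hZ a m : h (a *: m) = a *: h m.
  by have := hl a m 0; rewrite h0 !addr0.
have hD m m' : h (m + m') = h m + h m'.
  by have := hl 1 m m'; rewrite !scale1r.
have hS (I : finType) (P : pred I) (F : I -> M) :
    h (\sum_(i | P i) F i) = \sum_(i | P i) h (F i).
  by apply: (big_morph h hD h0).
apply/funext => u; rewrite /ce_diff /= hD !hS; congr (_ + _).
  by apply: eq_bigr => i _; rewrite hZ hx.
by apply: eq_bigr => i _; rewrite hS; apply: eq_bigr => j _; rewrite hZ.
Qed.

Lemma map_cochain (M N : lieModType g) (h : M -> N) n (f : ('I_n -> g) -> M) :
  linear h -> is_cochain f -> is_cochain (h \o f).
Proof.
move=> hl [fl fa]; split=> [u i a x y|u i j ij uij] /=; first by rewrite fl hl.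
rewrite (fa _ i j) //.
by have := hl (-1) 0 0; rewrite scaler0 addr0 scaleN1r addNr.
Qed.

Variable M : lieModType g.

(** Linear projection with kernel the embedded copy of [M], so its image models the quotient as a
    vector space. *)
Definition coind_residual (F : coindMod M) : coindMod M :=
  F - coind_embed (F [::]).

Lemma coind_residual_linear : linear coind_residual.
Proof.
move=> a F G; rewrite /coind_residual coindMod_linE linearP scalerBr opprD.
by rewrite addrACA.
Qed.

HB.instance Definition _ := GRing.isLinear.Build K (coindMod M) (coindMod M)
  *:%R coind_residual coind_residual_linear.

Lemma coind_residual_embed m : coind_residual (coind_embed m) = 0.
Proof. by rewrite /coind_residual subrr. Qed.

Lemma coind_residual_idem F :
  coind_residual (coind_residual F) = coind_residual F.
Proof. by rewrite {2}/coind_residual linearB /= coind_residual_embed subr0. Qed.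

Lemma coind_residual_lact x F :
  coind_residual (lact x (coind_residual F)) = coind_residual (lact x F).
Proof.
rewrite {2}/coind_residual lact_sub linearB /= -coind_embed_lact.
by rewrite coind_residual_embed subr0.
Qed.

Lemma coind_residual_compat : corner_compat coind_residual.
Proof.
by move=> x y F /=; rewrite coind_residual_idem coind_residual_lact.
Qed.

End Shift.

(* Dimension shifting along 0 -> M -> coindMod M, with the quotient encoded as
   the corner module of coind_residual. *)
Lemma acyclicS (K : fieldType) (g : lieAlgType K) n :
  acyclic g n.+1 -> acyclic g n.+2.
Proof.
move=> An M f [fc df].
have el := @coind_embed_linear K g M; have ex := @coind_embed_lact K g M.
have [b bc bE] : is_coboundary (@coind_embed K g M \o f).
  apply: coind_acyclic; split; first exact: map_cochain.
  by rewrite ce_diff_map // df; apply/funext => u /=; rewrite linear0.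
pose Q : lieModType g := corner (@coind_residual_compat K g M).
pose q : coindMod M -> Q := @coind_residual K g M.
have ql : linear q by apply: coind_residual_linear.
have qx x F : q (lact x F) = lact x (q F).
  rewrite -[RHS]/(coind_residual (lact x (coind_residual (coind_residual F)))).
  by rewrite coind_residual_idem coind_residual_lact.
(* The carrier of [Q] is all of [coindMod M]: the quotient plus a summand with zero action. [q']
   projects onto the former. *)
pose q' : Q -> Q := @coind_residual K g M.
have q'l : linear q' by apply: coind_residual_linear.
have q'x x F : q' (lact x F) = lact x (q' F).
  rewrite -[RHS]/(coind_residual (lact x (coind_residual (coind_residual F)))).
  by rewrite coind_residual_idem -[LHS]/(coind_residual (coind_residual _))
    coind_residual_idem.
have [c cc qbE] : is_coboundary (q \o b).
  apply: An; split; first exact: map_cochain.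
  rewrite ce_diff_map // -bE; apply/funext => u /=.
  exact: coind_residual_embed.
(* A linear lift, not equivariant. Since [q \o r] is [q'] and [q'] fixes [q \o b], subtracting the
   differential of [r \o c] from [b] leaves values in the embedded [M]. *)
pose r : Q -> coindMod M := @coind_residual K g M.
have rl : linear r by apply: coind_residual_linear.
have c'c : is_cochain (r \o c) by apply: map_cochain.
have qd : q \o ce_diff (r \o c) = q \o b.
  rewrite -ce_diff_map //.
  have -> : q \o (r \o c) = q' \o c.
    by apply/funext => u; apply: coind_residual_idem.
  rewrite ce_diff_map // -qbE; apply/funext => u.
  exact: coind_residual_idem.
pose d := b - ce_diff (r \o c).
have dc : is_cochain d by apply: is_cochainB => //; apply: ce_diff_cochain.
have dE : d = @coind_embed K g M \o (fun u => d u [::]).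
  apply/funext => u; apply/eqP; rewrite -subr_eq0.
  rewrite -[_ - _]/(coind_residual (d u)) /d.
  rewrite -[(b - _) u]/(b u - ce_diff (r \o c) u) linearB /=.
  by rewrite -[X in _ - X]/((q \o ce_diff (r \o c)) u) qd subrr.
exists (fun u => d u [::]); first exact: coind_eval_cochain.
apply/funext => u.
have : (@coind_embed K g M \o f) u
    = (@coind_embed K g M \o ce_diff (fun u => d u [::] : M)) u.
  by rewrite -ce_diff_map // -dE ce_diffB ce_diff_diff // subr0 -bE.
by move=> /(congr1 (fun F : coindMod M => F [::])).
Qed.

(** * Abelian extensions from 2-cocycles *)

Section TwoCocycle.
Variables (K : fieldType) (g : lieAlgType K) (M : lieModType g).

Definition pair_arg (x y : g) : 'I_2 -> g := prep x (fun=> y).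

Lemma pair_argE (u : 'I_2 -> g) : u = pair_arg (u ord0) (u (lift ord0 ord0)).
Proof.
rewrite /pair_arg {1}(prepE u); congr prep; apply/funext => i /=.
by rewrite ord1.
Qed.

Lemma ce_diff_1E (f : ('I_1 -> g) -> M) x y : is_cochain f ->
  ce_diff f (pair_arg x y)
  = lact x (f (fun=> y)) - lact y (f (fun=> x)) - f (fun=> bracket x y).
Proof.
move=> fc; rewrite -[LHS]/(inner x (ce_diff f) (fun=> y)) cartan //.
have e1 (h : ('I_1 -> g) -> M) (u v : 'I_1 -> g) : u ord0 = v ord0 -> h u = h v.
  by move=> uv; congr h; apply/funext => i; rewrite ord1.
rewrite /lieD !fctE big_ord_recl big_ord0 addr0 addrAC; congr (_ - _ - _).
  have := ce_diff_0 (inner x f) y.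
  move=> /(congr1 (fun h => h (fun i : 'I_0 => y))); rewrite /inner => /esym.
  rewrite (e1 f _ (fun=> x)) ?prep0 // => ->.
  by apply: e1; rewrite prep0.
exact: e1.
Qed.

Lemma ce_diff_2E (f : ('I_2 -> g) -> M) x y z : is_cochain f ->
  ce_diff f (prep x (pair_arg y z))
  = lact x (f (pair_arg y z)) - f (pair_arg (bracket x y) z)
    - f (pair_arg y (bracket x z))
    - (lact y (f (pair_arg x z)) - lact z (f (pair_arg x y))
       - f (pair_arg x (bracket y z))).
Proof.
move=> fc; rewrite -[LHS]/(inner x (ce_diff f) (pair_arg y z)) cartan //.
rewrite !fctE ce_diff_1E; last exact: inner_cochain.
congr (_ - _); rewrite /lieD big_ord_recl big_ord_recl big_ord0 addr0 opprD.
rewrite addrA /pair_arg prep0 prepS -prep_with0 -prep_with; congr (_ - _ - f (prep _ _)).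
by apply/funext => i; rewrite /= ord1.
Qed.

Variable f : ('I_2 -> g) -> M.
Variable fP : is_cocycle f.

Let form x y := f (pair_arg x y).

Let fc : is_cochain f. Proof. by case: fP. Qed.

Let form_linearl a x y z : form (a *: x + y) z = a *: form x z + form y z.
Proof.
have := proj1 fc (pair_arg 0 z) ord0 a x y.
by rewrite /form /pair_arg -!prep_with0.
Qed.

Let form_linearr a x y z : form z (a *: x + y) = a *: form z x + form z y.
Proof.
have := proj1 fc (pair_arg z 0) (lift ord0 ord0) a x y.
rewrite /form /pair_arg -!prep_with.
have e w : [eta fun _ : 'I_1 => 0 with ord0 |-> w] = (fun=> w) :> ('I_1 -> g).
  by apply/funext => i; rewrite /= ord1.
by rewrite !e.
Qed.

Let formxx x : form x x = 0.
Proof.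
apply: (proj2 fc _ ord0 (lift ord0 ord0)) => //.
by rewrite /pair_arg prep0 prepS.
Qed.

Let formC x y : form x y = - form y x.
Proof.
have formDl u v w : form (u + v) w = form u w + form v w.
  by have := form_linearl 1 u v w; rewrite !scale1r.
have formDr u v w : form w (u + v) = form w u + form w v.
  by have := form_linearr 1 u v w; rewrite !scale1r.
apply/eqP; rewrite -addr_eq0; have := formxx (x + y).
by rewrite formDl !formDr !formxx add0r addr0 => ->.
Qed.

Let form_cocycle x y z :
  lact x (form y z) + lact y (form z x) + lact z (form x y)
  + (form x (bracket y z) + form y (bracket z x) + form z (bracket x y)) = 0.
Proof.
have : ce_diff f (prep x (pair_arg y z)) = 0 by rewrite (proj2 fP).
rewrite ce_diff_2E // -!/(form _ _) => <-.
rewrite (formC z x) (formC (bracket x y) z) (bracketC z x).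
have -> : form y (- bracket x z) = - form y (bracket x z).
  have := form_linearr (-1) (bracket x z) 0 y; rewrite addr0 !scaleN1r => ->.
  have -> : form y 0 = 0.
    apply: (multilinear0 (i := lift ord0 ord0) (proj1 fc)).
    by rewrite /pair_arg prepS.
  by rewrite addr0.
rewrite raddfN /= !opprD !opprK !addrA.
by rewrite [LHS](ACl (1*6*5*2*3*4))/=.
Qed.

(** The phantom argument carries the cocycle condition into the Lie structure, where it gives the
    Jacobi identity. *)
Definition extension (_ : is_cocycle f) : Type := (M * g)%type.

HB.instance Definition _ := GRing.Lmodule.on (extension fP).

Definition ext_bracket (u v : extension fP) : extension fP :=
  (lact u.2 v.1 - lact v.2 u.1 + form u.2 v.2, bracket u.2 v.2).

Lemma ext_bracket_linearl a (x y z : extension fP) :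
  ext_bracket (a *: x + y) z = a *: ext_bracket x z + ext_bracket y z.
Proof.
congr pair; last exact: bracket_linearl.
rewrite /= lact_linearl linearP form_linearl !scalerDr scalerN opprD.
by rewrite !addrA [LHS](ACl (1*3*5*2*4*6))/=.
Qed.

Lemma ext_bracket_linearr a (x y z : extension fP) :
  ext_bracket z (a *: x + y) = a *: ext_bracket z x + ext_bracket z y.
Proof.
congr pair; last exact: bracket_linearr.
rewrite /= lact_linearl linearP form_linearr !scalerDr scalerN opprD.
by rewrite !addrA [LHS](ACl (1*3*5*2*4*6))/=.
Qed.

Lemma ext_bracketxx (x : extension fP) : ext_bracket x x = 0.
Proof. by rewrite /ext_bracket subrr formxx bracketxx addr0. Qed.

Lemma ext_bracket_jacobi (x y z : extension fP) :
  ext_bracket x (ext_bracket y z) + ext_bracket y (ext_bracket z x)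
  + ext_bracket z (ext_bracket x y) = 0.
Proof.
case: x y z => [a x] [b y] [c z]; congr pair; last exact: bracket_jacobi.
rewrite /= !raddfD /= !raddfN /= !lact_bracket !opprB.
rewrite -(form_cocycle x y z) !addrA.
rewrite [LHS](ACl (3*9*15*6*12*18*(1*17)*(10*2)*(4*14)*(7*5)*(16*8)*(13*11)))/=.
by rewrite !subrr !addr0.
Qed.

HB.instance Definition _ := isLieAlgebra.Build K (extension fP)
  ext_bracket_linearl ext_bracket_linearr ext_bracketxx ext_bracket_jacobi.

Lemma ext_bracketE (u v : extension fP) : bracket u v
  = (lact u.2 v.1 - lact v.2 u.1 + f (pair_arg u.2 v.2), bracket u.2 v.2).
Proof. by []. Qed.

End TwoCocycle.

Section FreeLie.
Variables (K : fieldType) (X : Type).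
Local Notation F := (freeLie K X).
Local Notation var := (@fl_var K X).

Lemma fl_ind (P : F -> Prop) : (forall x, P (var x)) -> P 0 ->
  (forall a u v, P u -> P v -> P (a *: u + v)) ->
  (forall u v, P u -> P v -> P (bracket u v)) -> forall u, P u.
Proof.
move=> Pv P0 Pl Pb; elim/fl_classW; elim=> [x||s IH|s IHs t IHt|a s IH|s IHs t IHt].
- exact: Pv.
- exact: P0.
- have -> : fl_class (Topp s) = (-1) *: fl_class s + 0.
    by rewrite scaleN1r addr0 -fl_class_opp.
  exact: Pl.
- have -> : fl_class (Tadd s t) = 1 *: fl_class s + fl_class t.
    by rewrite scale1r -fl_class_add.
  exact: Pl.
- have -> : fl_class (Tscale a s) = a *: fl_class s + 0.
    by rewrite addr0 -fl_class_scale.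
  exact: Pl.
- by rewrite -fl_class_bracket; apply: Pb.
Qed.

Lemma fl_lift_var (L : lieAlgType K) (h : X -> L) x : fl_lift h (var x) = h x.
Proof. exact: fl_liftE. Qed.

(* The extension of F by M attached to a 2-cocycle splits. *)
Lemma freeLie_acyclic2 : acyclic F 2.
Proof.
move=> M f fP; pose h x : extension fP := (0, var x).
have [fc _] := fP.
have h2 u : (fl_lift h u).2 = u.
  elim/fl_ind: u => [x||a u v IHu IHv|u v IHu IHv].
  - by rewrite fl_lift_var.
  - by rewrite raddf0.
  - by rewrite linearP /= IHu IHv.
  - by rewrite morph_bracket ext_bracketE /= IHu IHv.
(* Multiplicativity of the splitting says that its first component has differential [- f]; hence the
   sign. *)
pose s u := - (fl_lift h u).1.
have sl : linear s.
  by move=> a u v; rewrite /s linearP /= opprD scalerN.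
have bc : is_cochain (fun u : 'I_1 -> F => s (u ord0)).
  split=> [u i a x y|u i j]; last by rewrite !ord1.
  by rewrite (ord1 i) /= sl.
exists (fun u => s (u ord0)) => //; apply/funext => u.
rewrite (pair_argE u) ce_diff_1E // /s morph_bracket ext_bracketE /= !h2.
rewrite !raddfN /= opprK.
rewrite -[X in _ = X]addrA; move: (lact _ _) (lact _ _) => A B.
by rewrite opprK !addrA [RHS](ACl (5*(3*1)*(2*4)))/= !subrr !addr0.
Qed.

Lemma freeLie_acyclic n : acyclic F n.+2.
Proof. by elim: n => [|n IH]; [exact: freeLie_acyclic2|exact: acyclicS]. Qed.

End FreeLie.

(** * Functions on words *)


Section Endomorphisms.
Variables (K : fieldType) (V : lmodType K).

Definition linb : {pred V -> V} := fun h => `[< linear h >].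

Lemma linb_submod_closed : submod_closed linb.
Proof.
split=> [|a h h' /asboolP hl /asboolP h'l]; apply/asboolP => c x y.
  by rewrite [RHS]addr0 [RHS]scaler0.
by rewrite !fctE hl h'l !scalerDr !scalerA mulrC addrACA.
Qed.

HB.instance Definition _ :=
  GRing.isSubmodClosed.Build K (V -> V) linb linb_submod_closed.

(** The Lie algebra gl(V), so that the universal property of the free Lie algebra produces
    modules. *)
Record lend := Lend { lend_fun :> V -> V; _ : lend_fun \in linb }.

HB.instance Definition _ := [isSub for lend_fun].
HB.instance Definition _ := [Choice of lend by <:].
HB.instance Definition _ := [SubChoice_isSubLmodule of lend by <:].

Lemma lendP (h : lend) : linear h.
Proof. exact/asboolP/(valP h). Qed.

Lemma lendB (h : lend) x y : h (x - y) = h x - h y.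
Proof. by rewrite addrC -scaleN1r lendP scaleN1r addrC. Qed.

Lemma lend_ext (h h' : lend) : h =1 h' -> h = h'.
Proof. by move=> hh'; apply/val_inj/funext. Qed.

Lemma lend_bracket_subproof (h h' : lend) :
  (fun v => h (h' v) - h' (h v)) \in linb.
Proof.
apply/asboolP => a x y /=; rewrite !lendP.
rewrite scalerBr opprD.
by rewrite addrACA.
Qed.

Definition lend_bracket (h h' : lend) := Lend (lend_bracket_subproof h h').

Lemma lend_bracket_linearl a (x y z : lend) :
  lend_bracket (a *: x + y) z = a *: lend_bracket x z + lend_bracket y z.
Proof.
apply: lend_ext => v.
rewrite -[LHS]/((a *: x (z v) + y (z v)) - z (a *: x v + y v)).
rewrite -[RHS]/(a *: (x (z v) - z (x v)) + (y (z v) - z (y v))).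
by rewrite lendP scalerBr opprD addrACA.
Qed.

Lemma lend_bracket_linearr a (x y z : lend) :
  lend_bracket z (a *: x + y) = a *: lend_bracket z x + lend_bracket z y.
Proof.
apply: lend_ext => v.
rewrite -[LHS]/(z (a *: x v + y v) - (a *: x (z v) + y (z v))).
rewrite -[RHS]/(a *: (z (x v) - x (z v)) + (z (y v) - y (z v))).
by rewrite lendP scalerBr opprD addrACA.
Qed.

Lemma lend_bracketxx (x : lend) : lend_bracket x x = 0.
Proof. by apply: lend_ext => v; apply: subrr. Qed.

Lemma lend_bracket_jacobi (x y z : lend) :
  lend_bracket x (lend_bracket y z) + lend_bracket y (lend_bracket z x)
  + lend_bracket z (lend_bracket x y) = 0.
Proof.
apply: lend_ext => v.
rewrite -[LHS]/((x (y (z v) - z (y v)) - (y (z (x v)) - z (y (x v))))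
  + (y (z (x v) - x (z v)) - (z (x (y v)) - x (z (y v))))
  + (z (x (y v) - y (x v)) - (x (y (z v)) - y (x (z v))))).
rewrite !lendB !opprB !addrA.
rewrite [LHS](ACl ((1*12)*(7*2)*(5*4)*(3*10)*(9*8)*(11*6)))/=.
by rewrite !subrr !addr0.
Qed.

HB.instance Definition _ := isLieAlgebra.Build K lend
  lend_bracket_linearl lend_bracket_linearr lend_bracketxx lend_bracket_jacobi.

End Endomorphisms.

Section Words.
Variables (K : fieldType) (Y : Type) (W : lmodType K).
Local Notation F := (freeLie K Y).
Local Notation var := (@fl_var K Y).

(** Hom_K(T(Y), W) for the tensor algebra T(Y) = U(F(Y)), with right translation by letters. *)
Definition words := seq Y -> W.

HB.instance Definition _ := GRing.Lmodule.on words.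

Definition word_shift (y : Y) (psi : words) : words := fun w => psi (rcons w y).

Lemma word_shift_linear y : word_shift y \in @linb K words.
Proof. exact/asboolP. Qed.

Definition word_act (u : F) : words -> words :=
  fl_lift (fun y => Lend (word_shift_linear y)) u : lend words.

Lemma word_act_linearl a u v psi :
  word_act (a *: u + v) psi = a *: word_act u psi + word_act v psi.
Proof. by rewrite /word_act linearP. Qed.

Lemma word_act_linearr a u psi chi :
  word_act u (a *: psi + chi) = a *: word_act u psi + word_act u chi.
Proof. exact: lendP. Qed.

Lemma word_act_bracket u v psi : word_act (bracket u v) psi
  = word_act u (word_act v psi) - word_act v (word_act u psi).
Proof. by rewrite /word_act morph_bracket. Qed.

HB.instance Definition _ := isLieModule.Build K F words
  word_act_linearl word_act_linearr word_act_bracket.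

Lemma word_act_var y (psi : words) w : lact (var y) psi w = psi (rcons w y).
Proof. by rewrite -[lact _ _]/(word_act _ _) /word_act fl_lift_var. Qed.

Lemma word_act0 (psi : words) : lact (0 : F) psi = 0.
Proof. by rewrite -[0](scale0r 0) lactZl scale0r. Qed.

(** Restricting a form on U(F) to words in the generators is equivariant; this carries
    Poincare-Birkhoff-Witt over to [words]. *)
Lemma word_act_coind (G : seq F -> W) u w : coind G ->
  lact u ((fun s => G (map var s)) : words) w = G (rcons (map var w) u).
Proof.
elim/fl_ind: u G w => [y||a u v IHu IHv|u v IHu IHv] G w Gc.
- by rewrite word_act_var map_rcons.
- by rewrite word_act0 -cats1 (wmultilinear0 _ _ (proj1 Gc)).
- by rewrite lact_linearl -cats1 (proj1 Gc) !cats1 -IHu // -IHv.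
have act2 (x y : F) (ix : forall (H : seq F -> W) z, coind H ->
      lact x ((fun s => H (map var s)) : words) z = H (rcons (map var z) x))
    (iy : forall (H : seq F -> W) z, coind H ->
      lact y ((fun s => H (map var s)) : words) z = H (rcons (map var z) y)) :
    lact x (lact y ((fun s => G (map var s)) : words)) w
    = G (rcons (rcons (map var w) x) y).
  rewrite -(ix (fun s => G (rcons s y))); last exact: coind_rcons.
  by congr (word_act x _ w); apply/funext => s; rewrite -iy.
rewrite lact_bracket !fctE !act2 // -!cats1 -!catA /=.
by rewrite (proj2 Gc _ _ u v [::] erefl).
Qed.

Definition supp c (psi : words) := forall w, (c <= size w)%N -> psi w = 0.

Lemma suppW c psi : supp c psi -> supp c.+1 psi.
Proof. by move=> sp w cw; apply/sp/ltnW. Qed.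

(** Every element of the free Lie algebra is a sum of words of length at least one. *)
Lemma supp_lact c u psi : supp c.+1 psi -> supp c (lact u psi).
Proof.
elim/fl_ind: u c psi => [y||a u v IHu IHv|u v IHu IHv] c psi sp w cw.
- by rewrite word_act_var sp // size_rcons ltnS.
- by rewrite word_act0.
- by rewrite lact_linearl !fctE (IHu c) ?(IHv c) // scaler0 addr0.
rewrite lact_bracket !fctE (IHu c) ?(IHv c) ?subrr //.
  exact/suppW/IHu.
exact/suppW/IHv.
Qed.

Lemma word_act_local u : exists C, forall (psi chi : words) w,
  (forall x, (size x < size w + C)%N -> psi x = chi x) ->
  lact u psi w = lact u chi w.
Proof.
elim/fl_ind: u => [y||a u v [C IHu] [D IHv]|u v [C IHu] [D IHv]].
(* The bound is strict and the action reads [rcons w y], of length [size w + 1]. *)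
- exists 2 => psi chi w pc; rewrite !word_act_var pc // size_rcons; lia.
- by exists 0%N => psi chi w _; rewrite !word_act0.
- exists (C + D)%N => psi chi w pc; rewrite !lact_linearl !fctE.
  by rewrite (IHu psi chi) ?(IHv psi chi) // => x xw; apply: pc; lia.
exists (C + D)%N => psi chi w pc; rewrite !lact_bracket !fctE; congr (_ - _).
  by apply: IHu => x xw; apply: IHv => z zx; apply: pc; lia.
by apply: IHv => x xw; apply: IHu => z zx; apply: pc; lia.
Qed.

Definition cut c (psi : words) : words :=
  fun w => if (size w < c)%N then psi w else 0.

Lemma cut_linear c : linear (cut c).
Proof.
move=> a psi chi; apply/funext => w; rewrite /cut !fctE; case: ifP => _ //.
by rewrite scaler0 addr0.
Qed.

HB.instance Definition _ c := GRing.isLinear.Build K words words *:%R (cut c)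
  (cut_linear c).

Lemma cut_supp c psi : supp c (cut c psi).
Proof. by move=> w cw; rewrite /cut ltnNge cw. Qed.

Lemma cut_id c psi : supp c psi -> cut c psi = psi.
Proof.
by move=> sp; apply/funext => w; rewrite /cut; case: ltnP => // /sp.
Qed.

Lemma cut_lact c u psi : cut c (lact u (cut c psi)) = lact u (cut c psi).
Proof. exact/cut_id/supp_lact/suppW/cut_supp. Qed.

Lemma cut_compat c : corner_compat (cut c).
Proof. by move=> u v psi /=; rewrite ![cut c (lact v _)]cut_lact. Qed.

End Words.

(* A free Lie algebra embeds into its enveloping algebra: a nonzero element acts
   nontrivially on functions on words. *)
Lemma word_act_faithful (K : fieldType) (Y : Type) (u : freeLie K Y) : u <> 0 ->
  exists psi : words Y (freeLie K Y), lact u psi [::] <> 0.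
Proof.
(* With coefficients in the Lie algebra itself, the identity on one-letter words extends to all of
   U(F). *)
move=> u0; have [G Gc GE] := @coind_extension K (freeLie K Y) (freeLie K Y)
  (fun s => if s is [:: i] then basv i else 0).
exists (fun s => G (map (@fl_var K Y) s)); rewrite word_act_coind //=.
suff -> : G [:: u] = u by [].
elim/bas_ind: u {u0} => [|a u v IHu IHv|i].
- exact: (wmultilinear0 [::] [::] (proj1 Gc)).
- by rewrite -{2}IHu -{2}IHv; apply: (proj1 Gc [::] [::]).
- exact: (GE [:: i]).
Qed.

(** * Cohomological dimension *)


Section Degrees.
Variables (K : fieldType) (g h : lieAlgType K) (phi : {lie g -> h}).

Lemma coh_class0 n (M : lieModType g) :
  coh_class (0 : cocycle M n) = 0.
Proof. by rewrite /coh_class raddf0. Qed.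

Lemma coh_class_eq0 n (M : lieModType g) (z : cocycle M n) :
  coh_class z = 0 <-> is_coboundary (z : ('I_n -> g) -> M).
Proof. by rewrite -coh_class0 coh_classE subr0. Qed.

Lemma cd_degreesP n : cd_degrees phi n <->
  exists (M : lieModType h) (f : ('I_n -> h) -> M),
    is_cocycle f /\ ~ is_coboundary (pullback phi f).
Proof.
split=> [[M [c cn]]|[M [f [fP nf]]]].
  exists M, (coh_repr c); split; first exact: cocycleP.
  by move=> pc; apply: cn; apply/coh_class_eq0.
exists M, (coh_class (Cocycle (asboolT fP : f \in @cocycles K h M n))).
by rewrite induced_class => /coh_class_eq0.
Qed.

Lemma acyclic_cd_degrees n : acyclic h n.+1 -> ~ cd_degrees phi n.+1.
Proof.
move=> hn /cd_degreesP[M [f [/hn[b bc fE]]]]; apply.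
by exists (pullback phi b); [exact: pullback_cochain|rewrite pullback_diff -fE].
Qed.

End Degrees.

Section FreeLie.
Variables (K : fieldType) (X Y : Type).
Variable phi : {lie freeLie K X -> freeLie K Y}.

Lemma cd_degrees0 : cd_degrees phi 0.
Proof.
(* The corner of the zero map has trivial action, so any nonzero vector gives a nonzero class in
   degree 0. *)
have zc : corner_compat (\0 : {linear words Y K^o -> words Y K^o}) by [].
apply/cd_degreesP; exists (corner zc), (fun=> (fun=> 1) : words Y K^o).
split; last first.
  move=> /= /(congr1 (fun f => f (fun i : 'I_0 => False_rect _ (notF (ltn_ord i))) [::])).
  by move/eqP; rewrite oner_eq0.
split; first by split=> [u []|u []].
apply/funext => u; rewrite /ce_diff big_ord_recl big_ord0 big1.
  by rewrite !addr0 expr0 scale1r.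
by move=> i _; apply: big_pred0 => j; rewrite !ord1.
Qed.

Lemma cd_degrees1 : ~ (forall u, phi u = 0) -> cd_degrees phi 1.
Proof.
move=> /existsNP[u0 v0]; set v := phi u0 in v0.
have [psi0 psi0v] := word_act_faithful v0.
set W := freeLie K Y in psi0 psi0v.
pose P c := `[< exists psi : words Y W, supp c psi /\ lact v psi [::] <> 0 >].
have exP : exists c, P c.
  (* By locality, the value at the empty word survives cutting [psi0] to lengths below [C]. *)
  have [C Cv] := word_act_local W v; exists C; apply/asboolP.
  exists (cut C psi0); split; first exact: cut_supp.
  by rewrite -(Cv psi0) // => x xC; rewrite /cut xC.
case: (ex_minnP exP) => c /asboolP[psi [psic psiv]] cmin.
case: c psic cmin => [|c] psic cmin.
  case: psiv; have -> : psi = 0 by apply/funext => w; apply: psic.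
  by rewrite raddf0.
(* [supp] is a strict bound, so [psi] lives on lengths at most [c], while the values of [D] live on
   lengths below [c]. *)
pose M : lieModType (freeLie K Y) := corner (@cut_compat K Y W c).
pose D u : M := lact u psi.
have cutD u : cut c (D u) = D u by apply/cut_id/supp_lact.
have Dl : linear D by move=> a x y; exact: (lact_linearl a x y psi).
apply/cd_degreesP; exists M, (fun t => D (t ord0)); split.
  have Dc : is_cochain (fun t : 'I_1 -> freeLie K Y => D (t ord0)).
    split=> [t i a x y|t i j]; last by rewrite !ord1.
    by rewrite (ord1 i) /= Dl.
  split=> //; apply/funext => t; rewrite (pair_argE t) ce_diff_1E //.
  have actE x y : lact x (D y) = lact x (lact y psi) :> words Y W.
    rewrite -[LHS]/(cut c (lact x (cut c (D y)))) cut_lact.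
    by rewrite cutD.
  rewrite /D lact_bracket; apply/eqP; rewrite subr_eq0; apply/eqP.
  by rewrite -[RHS]/(_ - _ : words Y W) -!actE.
case=> b _ /(congr1 (fun f => f (fun=> u0) [::])).
rewrite /pullback -[LHS]/(lact v psi [::]) => vE; apply: psiv; rewrite vE.
pose e : 'I_0 -> freeLie K X := fun=> u0.
have -> : (fun=> u0) = prep u0 e by apply: prepP.
rewrite -[ce_diff b _]/(inner u0 (ce_diff b) e) ce_diff_0.
rewrite -[lact _ _]/(cut c (lact v (cut c (b e)))) cut_lact.
(* A primitive cut to lengths below [c] would satisfy [P c], below the minimum [c.+1]. *)
apply: contrapT => nz; suff /cmin : P c by rewrite ltnn.
by apply/asboolP; exists (cut c (b e)); split=> //; apply: cut_supp.
Qed.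

End FreeLie.

(** [supremum] chooses some supremum; the maximum is one, and suprema are unique. *)
Lemma supremum_max (A : set nat) m : A m -> (forall n, A n -> (n <= m)%N) ->
  supremum 0%:E [set (n%:Z)%:E | n in A] = (m%:Z)%:E.
Proof.
move=> Am Amax; set S := (X in supremum _ X).
have Sm : supremums S (m%:Z)%:E.
  split=> [_ [n An <-]|x]; first by rewrite lee_fin lez_nat; apply: Amax.
  by apply; exists m.
rewrite /supremum ifF; last first.
  by apply/negP => /eqP S0; have : S (m%:Z)%:E by [exists m]; rewrite S0.
by case: xgetP => [x -> Sx|/(_ _ Sm)//]; apply: is_subset1_supremums Sx Sm.
Qed.

Theorem theorem5p1 (K : fieldType) (X Y : Type)
    (phi : {lie freeLie K X -> freeLie K Y}) :
  (cd phi = 0%:E \/ cd phi = 1%:E)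
  /\ (~ (forall u : freeLie K X, phi u = 0) -> cd phi = 1%:E).
Proof.
have d0 := cd_degrees0 phi.
have d2 n : cd_degrees phi n -> (n <= 1)%N.
  case: n => [|[|n]] // /acyclic_cd_degrees-[]; exact: freeLie_acyclic.
have cd1 : cd_degrees phi 1 -> cd phi = 1%:E by move=> d1; apply: supremum_max.
split; last by move=> /cd_degrees1.
have [d1|d1] := pselect (cd_degrees phi 1); first by right; apply: cd1.
left; apply: supremum_max => // n nd; have := d2 _ nd.
by case: n nd => [|[|]].
Qed.
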